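(* Let $P=\{p_k\}_{k\ge1}$ be a system of Beurling generalized primes with associated generalized integers $\{n_k\}_{k\ge1}$, counting function $N(x)=\sum_{n_k<x}1$ and Chebyshev function $\psi(x)=\sum_{n_k<x}\Lambda(n_k)$. Suppose there is a constant $a>0$ such that $$\int_{1}^{\infty}\left|\frac{N(x)-ax}{x}\right|\frac{\mathrm{d}x}{x}<\infty$$ and $$N(x)=ax+o\!\left(\frac{x}{\log x}\right),\qquad x\to\infty .$$ Then $$0<\liminf_{x\to\infty}\frac{\psi(x)}{x}\quad\text{and}\quad\limsup_{x\to\infty}\frac{\psi(x)}{x}<\infty .$$
   Context: A system of Beurling generalized primes is a non-decreasing sequence $P=\{p_k\}_{k\ge1}$ of real numbers with $p_1>1$ and $p_k\to\infty$. The associated generalized integers $\{n_k\}_{k\ge1}$ are all finite products $p_{k_1}^{\alpha_1}\cdots p_{k_m}^{\alpha_m}$ (with $\alpha_j\geq 0$ integers), arranged in non-decreasing order and counted with multiplicity (i.e. according to the number of distinct ways of writing them as such products, distinct indices counting as distinct primes even if equal as real numbers). The generalized von Mangoldt function $\Lambda$ is defined so that $\psi(x)=\sum_{n_k<x}\Lambda(n_k)=\sum_{(k,j):\,p_k^j<x,\ j\ge1}\log p_k$. *)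

(* Defs.v *)
From Stdlib Require Import Reals Lra List Sorting.Sorted Arith ClassicalEpsilon.
Open Scope R_scope.

(* A Beurling generalized prime system, indexed from 0 (p 0 = p_1 of the paper). *)
Definition beurling_primes (p : nat -> R) : Prop :=
  1 < p 0%nat /\
  (forall k, p k <= p (S k)) /\
  (forall M : R, exists K : nat, forall k, (K <= k)%nat -> M <= p k).

(* A generalized integer, counted with multiplicity, is a finite multiset of
   prime indices, represented as a non-decreasing list of indices. *)
Definition gprod (p : nat -> R) (s : list nat) : R :=
  fold_right (fun i acc => p i * acc) 1 s.

Definition N_spec (p : nat -> R) (x : R) (n : nat) : Prop :=
  exists l : list (list nat),
    NoDup l /\ length l = n /\
    (forall s, In s l <-> (Sorted le s /\ gprod p s < x)).

Definition Ncount (p : nat -> R) (x : R) : R :=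
  INR (epsilon (inhabits 0%nat) (fun n => N_spec p x n)).

Definition psi_spec (p : nat -> R) (x : R) (v : R) : Prop :=
  exists l : list (nat * nat),
    NoDup l /\
    (forall kj, In kj l <-> ((1 <= snd kj)%nat /\ p (fst kj) ^ snd kj < x)) /\
    v = fold_right (fun kj acc => ln (p (fst kj)) + acc) 0 l.

Definition psi (p : nat -> R) (x : R) : R :=
  epsilon (inhabits 0) (fun v => psi_spec p x v).

(* Main.v *)
(** Write [N(t) = a t + R(t)], [phi b = psi(e^b) / e^b] and let [g] be a [C^2] bump on [[0, L]].
Summing [log n = sum_(q | n) Lambda(q)] against [g'(u - log n) / n] and applying Abel
summation on the [n]-side gives, with [S[h](s) = sum_q Lambda(q) / q * h(s - log q)],
<<
  J(u) = a S[g](u) + a S[g'](u) + int R(t) / t^2 (S[g'] + S[g''])(u - log t) dt,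
>>
where [J(u) = sum_n (log n / n) g'(u - log n)] tends to [a int g] because [R(t) = o(t / log t)].

Upper bound: if [phi <= B] up to [u], then [S[g''] = O(B / L)] and [S[g'] = O(B)]. The integral
over large [t] costs [o(1) B] by the [L^1] hypothesis; for bounded [t], [S[g'](u - log t)] differs
from [S[g'](u)] by [O(B / L)], and [S[|g'|](u)] is absorbed in [a S[g](u)] by AM-GM. Hence, for [L] large,
[S[g](u) <= C + eta B] with [eta] as small as desired, which bounds
[phi b - phi (b - 1) / e]. Since [phi] grows at most linearly, this recursion forces
[phi] to be bounded.

Lower bound: once [phi] is bounded, the integral over large [t] is negligible and every remaining term
of the identity is [O(phi u)], whereas [J(u)] tends to a positive limit. *)

Require Import Defs.
From Stdlib Require Import Reals Lra Lia List Permutation Sorting.Sorted Arith ClassicalEpsilon.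
From Coquelicot Require Import Coquelicot.
Open Scope R_scope.

(** * Generalized integers and prime powers *)

Definition decide (P : Prop) : bool :=
  if excluded_middle_informative P then true else false.

Lemma decideP (P : Prop) : decide P = true <-> P.
Proof.
  unfold decide; destruct (excluded_middle_informative P); split; auto; discriminate.
Qed.

Definition lsum {A : Type} (f : A -> R) (l : list A) : R :=
  fold_right (fun x acc => f x + acc) 0 l.

Definition indic (P : Prop) : R := if decide P then 1 else 0.

Lemma indic_true (P : Prop) : P -> indic P = 1.
Proof. unfold indic; intros H; apply (proj2 (decideP P)) in H; now rewrite H. Qed.

Lemma indic_false (P : Prop) : ~ P -> indic P = 0.
Proof.
  unfold indic; intros H; destruct (decide P) eqn:E; [apply (proj1 (decideP P)) in E; tauto | easy].
Qed.

Lemma indic_ge0 (P : Prop) : 0 <= indic P.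
Proof. unfold indic; destruct (decide P); lra. Qed.

Lemma indic_le1 (P : Prop) : indic P <= 1.
Proof. unfold indic; destruct (decide P); lra. Qed.

Lemma indic_iff (P Q : Prop) : (P <-> Q) -> indic P = indic Q.
Proof.
  intros H; destruct (classic P).
  - rewrite !indic_true; tauto.
  - rewrite !indic_false; tauto.
Qed.

Lemma indic_le (P Q : Prop) : (P -> Q) -> indic P <= indic Q.
Proof.
  intros H; destruct (classic P).
  - rewrite !indic_true; auto; lra.
  - rewrite (indic_false P); auto; apply indic_ge0.
Qed.

Lemma lsum_ext {A} (f g : A -> R) l :
  (forall x, In x l -> f x = g x) -> lsum f l = lsum g l.
Proof.
  induction l as [|x l IH]; intros H; [easy|]; simpl.
  rewrite (H x), IH; auto; [intros; apply H|]; simpl; auto.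
Qed.

Lemma lsum_le {A} (f g : A -> R) l :
  (forall x, In x l -> f x <= g x) -> lsum f l <= lsum g l.
Proof.
  induction l as [|x l IH]; intros H; simpl; [lra|].
  apply Rplus_le_compat; [apply H | apply IH; intros; apply H]; simpl; auto.
Qed.

Lemma lsum_plus {A} (f g : A -> R) l :
  lsum (fun x => f x + g x) l = lsum f l + lsum g l.
Proof. induction l as [|x l IH]; simpl; [lra|]; rewrite IH; lra. Qed.

Lemma lsum_scal {A} c (f : A -> R) l : lsum (fun x => c * f x) l = c * lsum f l.
Proof. induction l as [|x l IH]; simpl; [lra|]; rewrite IH; lra. Qed.

Lemma lsum_0 {A} (l : list A) : lsum (fun _ => 0) l = 0.
Proof. induction l as [|x l IH]; simpl; [easy|]; rewrite IH; lra. Qed.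

Lemma lsum_ge0 {A} (f : A -> R) l : (forall x, In x l -> 0 <= f x) -> 0 <= lsum f l.
Proof. intros H; rewrite <- (lsum_0 l); now apply lsum_le. Qed.

Lemma lsum_abs {A} (f : A -> R) l : Rabs (lsum f l) <= lsum (fun x => Rabs (f x)) l.
Proof.
  induction l as [|x l IH]; simpl; [rewrite Rabs_R0; lra|].
  eapply Rle_trans; [apply Rabs_triang | lra].
Qed.

Lemma lsum_swap {A B} (f : A -> B -> R) l m :
  lsum (fun x => lsum (fun y => f x y) m) l = lsum (fun y => lsum (fun x => f x y) l) m.
Proof.
  induction l as [|x l IH]; simpl; [now rewrite lsum_0|].
  now rewrite IH, <- lsum_plus.
Qed.

Lemma lsum_map {A B} (f : B -> R) (h : A -> B) l :
  lsum f (map h l) = lsum (fun x => f (h x)) l.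
Proof. induction l as [|x l IH]; simpl; [easy|]; now rewrite IH. Qed.

Lemma lsum_filter {A} (f : A -> R) (P : A -> Prop) l :
  lsum f (filter (fun x => decide (P x)) l) = lsum (fun x => indic (P x) * f x) l.
Proof.
  induction l as [|x l IH]; simpl; [easy|].
  unfold indic at 1; destruct (decide (P x)); simpl; rewrite IH; lra.
Qed.

Lemma lsum_perm {A} (f : A -> R) l m : Permutation l m -> lsum f l = lsum f m.
Proof. induction 1; simpl; lra. Qed.

Lemma lsum_1 {A} (l : list A) : lsum (fun _ => 1) l = INR (length l).
Proof.
  induction l as [|x l IH]; [easy|].
  change (length (x :: l)) with (S (length l)); rewrite S_INR, <- IH; simpl; lra.
Qed.

Lemma lsum_point {A} (f : A -> R) l a :
  NoDup l -> In a l -> lsum (fun x => indic (x = a) * f x) l = f a.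
Proof.
  intros Hl Ha.
  rewrite <- lsum_filter.
  rewrite (lsum_perm f _ (a :: nil)); [simpl; lra|].
  apply NoDup_Permutation.
  - now apply NoDup_filter.
  - constructor; [easy | constructor].
  - intros x; rewrite filter_In, decideP; simpl; intuition; subst; auto.
Qed.

Lemma NoDup_ext_lsum {A} (f : A -> R) l m :
  NoDup l -> NoDup m -> (forall x, In x l <-> In x m) -> lsum f l = lsum f m.
Proof. intros; now apply lsum_perm, NoDup_Permutation. Qed.

(** Any finite list covering [P] is enough: filtering by [P] and removing duplicates, both by
    classical decision, leaves an exact enumeration. *)
Lemma finite_enumeration {A} (P : A -> Prop) (l : list A) :
  (forall x, P x -> In x l) -> exists m, NoDup m /\ forall x, In x m <-> P x.
Proof.
  intros H.
  exists (nodup (fun x y => excluded_middle_informative (x = y)) (filter (fun x => decide (P x)) l)).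
  split; [apply NoDup_nodup|].
  intros x; rewrite nodup_In, filter_In, decideP; split; [tauto | auto].
Qed.


(** * Finiteness below a bound, and the counting functions as finite sums *)

Lemma prime_gt1 p : beurling_primes p -> forall k, 1 < p 0%nat <= p k.
Proof.
  intros (H0 & Hm & _) k; split; auto.
  induction k as [|k IH]; [lra|]; specialize (Hm k); lra.
Qed.

Lemma gprod_ge1 p : beurling_primes p -> forall s, 1 <= gprod p s.
Proof.
  intros Hp s; induction s as [|i s IH]; simpl; [lra|].
  destruct (prime_gt1 p Hp i); nra.
Qed.

Lemma gprod_ge_pow p : beurling_primes p -> forall s, p 0%nat ^ length s <= gprod p s.
Proof.
  intros Hp s; induction s as [|i s IH]; simpl; [lra|].
  destruct (prime_gt1 p Hp i).
  assert (0 <= p 0%nat ^ length s) by (apply pow_le; lra).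
  apply Rmult_le_compat; lra.
Qed.

Lemma gprod_ge_member p : beurling_primes p -> forall s i, In i s -> p i <= gprod p s.
Proof.
  intros Hp s; induction s as [|k s IH]; simpl; [easy|]; intros i [->|Hi].
  - destruct (prime_gt1 p Hp i); pose proof (gprod_ge1 p Hp s); nra.
  - specialize (IH i Hi); destruct (prime_gt1 p Hp k), (prime_gt1 p Hp i); nra.
Qed.

Fixpoint lists_upto (K L : nat) : list (list nat) :=
  match L with
  | O => nil :: nil
  | S L => nil :: flat_map (fun s => map (fun i => i :: s) (seq 0 K)) (lists_upto K L)
  end.

Lemma in_lists_upto K L s :
  (forall i, In i s -> (i < K)%nat) -> (length s <= L)%nat -> In s (lists_upto K L).
Proof.
  revert s; induction L as [|L IH]; intros [|i s] Hs Hl; simpl in *; auto; [lia|].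
  right; apply in_flat_map; exists s; split; [apply IH; [auto | lia]|].
  apply in_map_iff; exists i; split; auto; apply in_seq; specialize (Hs i); intuition lia.
Qed.

(** Two bounds confine the index list: each member [i] satisfies [p i <= gprod p s < x] while [p k]
    tends to infinity, and [p 0 ^ length s <= gprod p s < x] with [p 0 > 1] limits the length. *)
Lemma integers_finite p x :
  beurling_primes p ->
  exists l, NoDup l /\ forall s, In s l <-> (Sorted le s /\ gprod p s < x).
Proof.
  intros Hp; pose proof Hp as (H0 & _ & Hinf).
  destruct (Hinf x) as [K HK].
  destruct (Pow_x_infinity (p 0%nat)) with (b := x) as [L HL];
    [rewrite Rabs_pos_eq; lra|].
  apply (finite_enumeration (fun s => Sorted le s /\ gprod p s < x) (lists_upto K L)).
  intros s [_ Hs]; apply in_lists_upto.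
  - intros i Hi; destruct (Nat.lt_ge_cases i K) as [|Hge]; auto; exfalso.
    specialize (HK i Hge); pose proof (gprod_ge_member p Hp s i Hi); lra.
  - destruct (Nat.le_gt_cases (length s) L) as [|Hgt]; auto; exfalso.
    specialize (HL (length s)); rewrite Rabs_pos_eq in HL by (apply pow_le; lra).
    pose proof (gprod_ge_pow p Hp s); assert (p 0%nat ^ length s >= x) by (apply HL; lia); lra.
Qed.

Lemma gprod_repeat p k j : gprod p (repeat k j) = p k ^ j.
Proof. induction j as [|j IH]; simpl; [easy|]; now rewrite IH. Qed.

Lemma Sorted_repeat k j : Sorted le (repeat k j).
Proof.
  induction j as [|j IH]; simpl; constructor; auto.
  destruct j; simpl; constructor; auto.
Qed.

(** The case [j = 0] has to be excluded, since the empty list forgets [k]. *)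
Lemma repeat_inj (k j k' j' : nat) :
  (1 <= j)%nat -> repeat k j = repeat k' j' -> (k, j) = (k', j').
Proof.
  intros Hj E.
  assert (j = j') by (rewrite <- (repeat_length k j), E; apply repeat_length); subst j'.
  destruct j; [lia|]; simpl in E; now injection E as -> _.
Qed.

(** The prime power of index [(k, j)] is the generalized integer [repeat k j], from which [(k, j)]
    is read back as head and length; finiteness is therefore inherited from the integers. *)
Lemma prime_powers_finite p x :
  beurling_primes p ->
  exists l, NoDup l /\
    forall kj : nat * nat, In kj l <-> ((1 <= snd kj)%nat /\ p (fst kj) ^ snd kj < x).
Proof.
  intros Hp; destruct (integers_finite p x Hp) as (l & _ & Hl).
  apply (finite_enumeration _ (map (fun s => (hd 0%nat s, length s)) l)).
  intros [k j]; simpl; intros [Hj Hx]; apply in_map_iff; exists (repeat k j); split.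
  - rewrite repeat_length; destruct j; [lia | easy].
  - apply Hl; rewrite gprod_repeat; split; auto; apply Sorted_repeat.
Qed.

(** The value picked by [epsilon] is forced: two duplicate-free lists with the same members are
    permutations of each other, hence equally long. The same argument fixes [psi]. *)
Lemma Ncount_eq p x l :
  NoDup l -> (forall s, In s l <-> (Sorted le s /\ gprod p s < x)) ->
  Ncount p x = INR (length l).
Proof.
  intros Hnd Hl; unfold Ncount; f_equal.
  assert (Hs : N_spec p x (length l)) by (exists l; auto).
  pose proof (epsilon_spec (inhabits 0%nat) (fun n => N_spec p x n) (ex_intro _ _ Hs))
    as (m & Hm & <- & Hm').
  apply Permutation_length, NoDup_Permutation; auto.
  intros s; rewrite Hl, Hm'; tauto.
Qed.

Lemma psi_eq p x l :
  NoDup l ->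
  (forall kj, In kj l <-> ((1 <= snd kj)%nat /\ p (fst kj) ^ snd kj < x)) ->
  psi p x = lsum (fun kj => ln (p (fst kj))) l.
Proof.
  intros Hnd Hl; unfold psi.
  assert (Hs : psi_spec p x (lsum (fun kj => ln (p (fst kj))) l)) by (exists l; auto).
  pose proof (epsilon_spec (inhabits 0) (fun v => psi_spec p x v) (ex_intro _ _ Hs))
    as (m & Hm & Hm' & ->).
  apply (NoDup_ext_lsum (fun kj => ln (p (fst kj)))); auto.
  intros s; rewrite Hl, Hm'; tauto.
Qed.

Definition is_integers p T (l : list (list nat)) : Prop :=
  NoDup l /\ forall s, In s l <-> (Sorted le s /\ gprod p s < T).

Definition is_prime_powers (p : nat -> R) T (l : list (nat * nat)) : Prop :=
  NoDup l /\
  forall kj, In kj l <-> ((1 <= snd kj)%nat /\ p (fst kj) ^ snd kj < T).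

(** A single list cut at [T] serves every [t <= T], so [N] becomes a finite sum of unit steps that
    can be integrated term by term. *)
Lemma Ncount_lsum p T l t :
  is_integers p T l -> t <= T -> Ncount p t = lsum (fun s => indic (gprod p s < t)) l.
Proof.
  intros [Hnd Hl] Ht.
  rewrite (Ncount_eq p t (filter (fun s => decide (gprod p s < t)) l)).
  - rewrite <- lsum_1, lsum_filter; apply lsum_ext; intros; lra.
  - now apply NoDup_filter.
  - intros s; rewrite filter_In, decideP, Hl; intuition lra.
Qed.

Lemma psi_lsum p T l t :
  is_prime_powers p T l -> t <= T ->
  psi p t = lsum (fun kj => indic (p (fst kj) ^ snd kj < t) * ln (p (fst kj))) l.
Proof.
  intros [Hnd Hl] Ht.
  rewrite (psi_eq p t (filter (fun kj => decide (p (fst kj) ^ snd kj < t)) l)).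
  - now rewrite lsum_filter.
  - now apply NoDup_filter.
  - intros s; rewrite filter_In, decideP, Hl; intuition lra.
Qed.

(** The map from [(k, j)] to [repeat k j] embeds the prime powers below [x] into the integers below
    [x], and each weight is at most [ln x]. This crude bound feeds the linear growth of [phi]. *)
Lemma psi_le_Ncount_ln p x : beurling_primes p -> 1 <= x -> psi p x <= Ncount p x * ln x.
Proof.
  intros Hp Hx.
  destruct (integers_finite p x Hp) as (l & Hl & Hl').
  destruct (prime_powers_finite p x Hp) as (m & Hm & Hm').
  rewrite (Ncount_eq p x l), (psi_eq p x m); auto.
  assert (Hlen : (length m <= length l)%nat).
  { rewrite <- (length_map (fun kj => repeat (fst kj) (snd kj)) m).
    apply NoDup_incl_length.
    - apply NoDup_map_NoDup_ForallPairs; auto.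
      intros [k j] [k' j'] H1 H2; simpl.
      apply Hm' in H1; simpl in H1; apply repeat_inj; tauto.
    - intros s; rewrite in_map_iff; intros ([k j] & <- & Hkj); apply Hm' in Hkj; simpl in *.
      apply Hl'; rewrite gprod_repeat; split; [apply Sorted_repeat | tauto]. }
  assert (0 <= ln x) by (rewrite <- ln_1; destruct (Req_dec x 1); [subst; lra | left; apply ln_increasing; lra]).
  apply Rle_trans with (lsum (fun _ => ln x * 1) m).
  - apply lsum_le; intros [k j] Hkj; apply Hm' in Hkj; simpl in *; destruct Hkj as [Hj Hkj].
    destruct (prime_gt1 p Hp k).
    rewrite Rmult_1_r; apply ln_le; [lra|].
    apply Rle_trans with (p k ^ j); [|lra].
    rewrite <- (pow_1 (p k)) at 1; apply Rle_pow; [lra | auto].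
  - rewrite lsum_scal, lsum_1; apply le_INR in Hlen; nra.
Qed.

(** * Multiplication and division by a prime, on sorted lists of indices *)

Fixpoint ins (k : nat) (s : list nat) : list nat :=
  match s with
  | nil => k :: nil
  | i :: s' => if (k <=? i)%nat then k :: s else i :: ins k s'
  end.

Fixpoint del (k : nat) (s : list nat) : list nat :=
  match s with
  | nil => nil
  | i :: s' => if (k =? i)%nat then s' else i :: del k s'
  end.

Lemma gprod_ins p k s : gprod p (ins k s) = p k * gprod p s.
Proof.
  induction s as [|i s IH]; simpl; [lra|].
  destruct (k <=? i)%nat; simpl; [lra|]; rewrite IH; lra.
Qed.

Lemma del_ins k s : del k (ins k s) = s.
Proof.
  induction s as [|i s IH]; simpl; [now rewrite Nat.eqb_refl|].
  destruct (Nat.leb_spec k i); simpl; [now rewrite Nat.eqb_refl|].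
  destruct (Nat.eqb_spec k i); [lia|]; now rewrite IH.
Qed.

Lemma HdRel_ins a k s : (a <= k)%nat -> HdRel le a s -> HdRel le a (ins k s).
Proof.
  intros Hak Hs; destruct s as [|i s]; simpl; [now constructor|].
  inversion Hs; subst; destruct (Nat.leb_spec k i); now constructor.
Qed.

Lemma Sorted_ins k s : Sorted le s -> Sorted le (ins k s).
Proof.
  induction s as [|i s IH]; simpl; intros Hs; [now repeat constructor|].
  destruct (Nat.leb_spec k i).
  - constructor; auto.
  - inversion Hs; subst; constructor; auto; apply HdRel_ins; auto; lia.
Qed.

Lemma Sorted_del k s : Sorted le s -> Sorted le (del k s).
Proof.
  intros Hs; apply Sorted_StronglySorted in Hs; [|intros ? ? ?; lia].
  apply StronglySorted_Sorted.
  induction Hs as [|i s Hs IH Hi]; simpl; [constructor|].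
  destruct (Nat.eqb_spec k i); auto.
  constructor; auto.
  rewrite Forall_forall in *; intros x Hx; apply Hi.
  clear - Hx; induction s as [|y s IH]; simpl in *; auto.
  destruct (k =? y)%nat; simpl in *; intuition.
Qed.

Lemma ins_del k s : Sorted le s -> In k s -> ins k (del k s) = s.
Proof.
  intros Hs; apply Sorted_StronglySorted in Hs; [|intros ? ? ?; lia].
  induction Hs as [|i s Hs IH Hi]; simpl; [easy|]; intros Hk.
  destruct (Nat.eqb_spec k i) as [->|Hne].
  - destruct s as [|y s]; simpl; auto.
    inversion Hi; subst; destruct (Nat.leb_spec i y); [easy | lia].
  - destruct Hk as [->|Hk]; [easy|]; simpl.
    rewrite Forall_forall in Hi; specialize (Hi k Hk).
    destruct (Nat.leb_spec k i); [lia|]; now rewrite IH.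
Qed.

Notation occ := (count_occ Nat.eq_dec).

Lemma occ_ins k s : occ (ins k s) k = S (occ s k).
Proof.
  induction s as [|i s IH]; simpl; [destruct (Nat.eq_dec k k); [easy | lia]|].
  destruct (Nat.leb_spec k i); simpl; [destruct (Nat.eq_dec k k); [easy | lia]|].
  now destruct (Nat.eq_dec i k); rewrite IH.
Qed.

Fixpoint insn (k j : nat) (s : list nat) : list nat :=
  match j with O => s | S j => ins k (insn k j s) end.

Lemma gprod_insn p k j s : gprod p (insn k j s) = p k ^ j * gprod p s.
Proof.
  induction j as [|j IH]; simpl; [lra|].
  rewrite gprod_ins; rewrite IH; lra.
Qed.

Lemma Sorted_insn k j s : Sorted le s -> Sorted le (insn k j s).
Proof. intros Hs; induction j as [|j IH]; simpl; auto; now apply Sorted_ins. Qed.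

Lemma occ_insn k j s : occ (insn k j s) k = (j + occ s k)%nat.
Proof. induction j as [|j IH]; simpl; auto; rewrite occ_ins; lia. Qed.

Lemma insn_inj k j s s' : insn k j s = insn k j s' -> s = s'.
Proof.
  induction j as [|j IH]; simpl; auto; intros E.
  apply IH; rewrite <- (del_ins k (insn k j s)), <- (del_ins k (insn k j s')).
  now rewrite E.
Qed.

(** The multiples of [p k ^ j] are the lists in which [k] occurs at least [j] times: deleting [k]
    repeatedly gives the cofactor. *)
Lemma insn_surj k j s :
  Sorted le s -> (j <= occ s k)%nat -> exists s', Sorted le s' /\ insn k j s' = s.
Proof.
  revert s; induction j as [|j IH]; intros s Hs Hj; [now exists s|].
  assert (Hk : In k s) by (apply (count_occ_In Nat.eq_dec); lia).
  destruct (IH (del k s)) as (s' & Hs' & E).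
  - now apply Sorted_del.
  - rewrite <- (ins_del k s Hs Hk), occ_ins in Hj; lia.
  - exists s'; split; auto; simpl; rewrite E; now apply ins_del.
Qed.

(** This is [log n = sum_(q | n) Lambda(q)]: the prime powers dividing [n] are the pairs [(k, j)]
    with [1 <= j <= occ s k], and the indicator selects them from a possibly larger list [m]. *)
Lemma ln_gprod p m :
  beurling_primes p -> NoDup m ->
  forall s, (forall k j, (1 <= j <= occ s k)%nat -> In (k, j) m) ->
  ln (gprod p s) =
  lsum (fun kj => indic (1 <= snd kj <= occ s (fst kj))%nat * ln (p (fst kj))) m.
Proof.
  intros Hp Hm; induction s as [|i s IH]; intros Hin.
  - simpl; rewrite ln_1; rewrite <- (lsum_0 m); apply lsum_ext; intros [k j] _; simpl.
    rewrite indic_false; [lra | lia].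
  - destruct (prime_gt1 p Hp i) as [H0 Hi]; pose proof (gprod_ge1 p Hp s).
    simpl gprod; rewrite ln_mult, IH; try lra.
    (* Passing from [s] to [i :: s] adds exactly one dividing prime power, the pair
       [(i, S (occ s i))]. *)
    + change (ln (p i)) with (ln (p (fst (i, S (occ s i))))).
      rewrite <- (lsum_point (fun kj => ln (p (fst kj))) m (i, S (occ s i))); auto.
      * rewrite <- lsum_plus; apply lsum_ext; intros [k j] _; simpl fst; simpl snd.
        rewrite <- Rmult_plus_distr_r; f_equal.
        simpl occ; destruct (Nat.eq_dec i k) as [->|Hne].
        -- destruct (Nat.eq_dec j (S (occ s k))) as [->|Hj].
           ++ rewrite indic_true, indic_false, indic_true; auto; try lia; lra.
           ++ rewrite (indic_false ((k, j) = _)) by congruence.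
              rewrite Rplus_0_l; apply indic_iff; lia.
        -- rewrite (indic_false ((k, j) = _)) by congruence; lra.
      * apply Hin; simpl; destruct (Nat.eq_dec i i); [lia | easy].
    + intros k j Hj; apply Hin; simpl; destruct (Nat.eq_dec i k); lia.
Qed.

Lemma pow_occ_le_gprod p : beurling_primes p ->
  forall s k, p k ^ occ s k <= gprod p s.
Proof.
  intros Hp s k; destruct (prime_gt1 p Hp k).
  induction s as [|i s IH]; simpl; [lra|].
  destruct (Nat.eq_dec i k) as [->|_]; simpl; [nra|].
  destruct (prime_gt1 p Hp i); pose proof (gprod_ge1 p Hp s); nra.
Qed.

(** The Dirichlet convolution of [1] and [Lambda] tested against [F]: the two sums are exchanged,
    and the multiples of a fixed prime power are parametrized by their cofactors. Since [F] vanishes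
    from [T] on, the inner sum may run over all of [l], including cofactors whose product reaches
    [T]. *)
Lemma log_convolution p T l m (F : R -> R) :
  beurling_primes p -> is_integers p T l -> is_prime_powers p T m ->
  (forall x, T <= x -> F x = 0) ->
  lsum (fun s => ln (gprod p s) * F (gprod p s)) l =
  lsum (fun kj => ln (p (fst kj)) *
          lsum (fun s => F (p (fst kj) ^ snd kj * gprod p s)) l) m.
Proof.
  intros Hp [Hl Hl'] [Hm Hm'] HF.
  transitivity (lsum (fun s => lsum (fun kj =>
    ln (p (fst kj)) * (indic (1 <= snd kj <= occ s (fst kj))%nat * F (gprod p s))) m) l).
  { apply lsum_ext; intros s Hs; apply Hl' in Hs.
    rewrite (ln_gprod p m Hp Hm).
    - rewrite Rmult_comm, <- lsum_scal; apply lsum_ext; intros; lra.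
    - intros k j Hj; apply Hm'; simpl; split; [lia|].
      apply Rle_lt_trans with (gprod p s); [|tauto].
      apply Rle_trans with (p k ^ occ s k); [|now apply pow_occ_le_gprod].
      destruct (prime_gt1 p Hp k); apply Rle_pow; [lra | lia]. }
  rewrite lsum_swap; apply lsum_ext; intros [k j] Hkj; apply Hm' in Hkj; simpl in *.
  destruct (prime_gt1 p Hp k) as [Hp0 Hpk].
  rewrite lsum_scal; f_equal.
  transitivity (lsum (fun s => F (gprod p s))
                  (filter (fun s => decide (1 <= j <= occ s k)%nat) l));
    [now rewrite lsum_filter|].
  (* The integers below [T] divisible by [p k ^ j] are the images under [insn k j] of the cofactors
     whose product stays below [T]. *)
  transitivity (lsum (fun s => F (gprod p s))
    (map (insn k j) (filter (fun s => decide (p k ^ j * gprod p s < T)) l))).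
  - apply lsum_perm, NoDup_Permutation.
    + now apply NoDup_filter.
    + apply NoDup_map_NoDup_ForallPairs; [|now apply NoDup_filter].
      intros s s' _ _; apply insn_inj.
    + intros s; rewrite in_map_iff, filter_In, decideP; split.
      * intros [Hs [_ Hj]]; apply Hl' in Hs.
        destruct (insn_surj k j s) as (s' & Hs' & E); [tauto | auto |].
        exists s'; split; auto; subst s; rewrite gprod_insn in Hs.
        apply filter_In; rewrite decideP, Hl'; repeat split; auto; try tauto.
        apply Rle_lt_trans with (p k ^ j * gprod p s'); [|tauto].
        pose proof (pow_R1_Rle (p k) j); pose proof (gprod_ge1 p Hp s'); nra.
      * intros (s' & <- & H); apply filter_In in H; rewrite decideP, Hl' in H.
        rewrite occ_insn, Hl', gprod_insn; repeat split; try tauto; try lia.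
        now apply Sorted_insn.
  - rewrite lsum_map, lsum_filter; apply lsum_ext; intros s _; rewrite gprod_insn.
    destruct (Rlt_le_dec (p k ^ j * gprod p s) T).
    + rewrite indic_true; auto; lra.
    + rewrite HF; auto; lra.
Qed.

(** * The bump function *)

Definition ppart (x : R) : R := Rmax 0 x.

Lemma ppart_eq x : 0 <= x -> ppart x = x.
Proof. apply Rmax_right. Qed.

Lemma ppart_0 x : x <= 0 -> ppart x = 0.
Proof. apply Rmax_left. Qed.

Lemma ppart_ge0 x : 0 <= ppart x.
Proof. apply Rmax_l. Qed.

Lemma continuous_ppart x : continuous ppart x.
Proof.
  apply continuous_ext with (fun y => (y + Rabs y) / 2).
  - intros y; unfold ppart, Rmax, Rabs; destruct (Rle_dec 0 y), (Rcase_abs y); lra.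
  - apply (continuous_mult (fun y => y + Rabs y) (fun _ => / 2)).
    + apply (continuous_plus (fun y : R => y) Rabs); [apply continuous_id | apply continuous_Rabs].
    + apply continuous_const.
Qed.

(** Away from [0] the function is locally [0] or [y ^ 2]. At [0] the difference quotient is at most
    [|h|] in absolute value, so [eps] itself serves as the radius. *)
Lemma is_derive_ppart2 x : is_derive (fun y => ppart y ^ 2) x (2 * ppart x).
Proof.
  destruct (Rtotal_order x 0) as [Hx|[->|Hx]].
  - rewrite ppart_0 by lra.
    apply is_derive_ext_loc with (fun _ => 0).
    + assert (Hd : 0 < - x) by lra.
      exists (mkposreal _ Hd); intros y Hy; apply Rabs_lt_between' in Hy; simpl in Hy.
      rewrite ppart_0; lra.
    + rewrite Rmult_0_r; apply (is_derive_const (V := R_NormedModule)).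
  - rewrite ppart_0 by lra; rewrite Rmult_0_r.
    apply is_derive_Reals; intros eps Heps.
    exists (mkposreal eps Heps); intros h Hh0 Hh; simpl in Hh.
    rewrite Rplus_0_l, (ppart_0 0) by lra.
    replace ((ppart h ^ 2 - 0 ^ 2) / h - 0) with (ppart h * (ppart h / h)) by (field; auto).
    apply Rabs_def2 in Hh.
    destruct (Rle_lt_dec h 0) as [H|H].
    + rewrite ppart_0 by lra; rewrite Rmult_0_l, Rabs_R0; lra.
    + rewrite ppart_eq by lra; replace (h * (h / h)) with h by (field; lra).
      rewrite Rabs_pos_eq; lra.
  - rewrite ppart_eq by lra.
    apply is_derive_ext_loc with (fun y => y ^ 2).
    + exists (mkposreal _ Hx); intros y Hy; apply Rabs_lt_between' in Hy; simpl in Hy.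
      rewrite ppart_eq; lra.
    + auto_derive; auto; ring.
Qed.

(** Writing the cube as [y * ppart y ^ 2] reduces it to the product rule, without a new study of the
    kink. *)
Lemma is_derive_ppart3 x : is_derive (fun y => ppart y ^ 3) x (3 * ppart x ^ 2).
Proof.
  apply is_derive_ext with (fun y => y * ppart y ^ 2).
  - intros y; change (y * ppart y ^ 2 = ppart y ^ 3 :> R); destruct (Rle_lt_dec y 0).
    + rewrite ppart_0 by lra; ring.
    + rewrite ppart_eq by lra; ring.
  - replace (3 * ppart x ^ 2) with (1 * ppart x ^ 2 + x * (2 * ppart x)).
    + apply (is_derive_mult (fun y : R => y) (fun y => ppart y ^ 2)).
      * apply (is_derive_id (K := R_AbsRing)).
      * apply is_derive_ppart2.
      * intros; apply Rmult_comm.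
    + destruct (Rle_lt_dec x 0).
      * rewrite ppart_0 by lra; ring.
      * rewrite ppart_eq by lra; ring.
Qed.

(** With [s = w / L] this is [s^3 (1 - s)^3] between [0] and [L] and zero elsewhere; cubes are the
    smallest integer powers that make it [C^2] across both ends. *)
Definition bump (L w : R) : R := ppart (w / L) ^ 3 * ppart (1 - w / L) ^ 3.

(** The first derivative, kept in terms of [P = ppart (w / L) * ppart (1 - w / L)]: it is of order
    [P^2] where [bump] is [P^3], which is what the AM-GM bound exploits. *)
Definition bump1 (L w : R) : R :=
  3 * (ppart (w / L) * ppart (1 - w / L)) ^ 2 * (ppart (1 - w / L) - ppart (w / L)) / L.

Definition bump2 (L w : R) : R :=
  (6 * (ppart (w / L) * ppart (1 - w / L)) * (ppart (1 - w / L) ^ 2 + ppart (w / L) ^ 2)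
   - 18 * (ppart (w / L) * ppart (1 - w / L)) ^ 2) / L ^ 2.

Lemma is_derive_left L n c w : 0 < L ->
  (forall x, is_derive (fun y => ppart y ^ n) x (c x)) ->
  is_derive (fun y => ppart (y / L) ^ n) w (c (w / L) / L).
Proof.
  intros HL H.
  replace (c (w / L) / L) with ((/ L) * c (w / L)) by (unfold Rdiv; ring).
  apply (is_derive_comp (fun y => ppart y ^ n) (fun y => y / L)); auto.
  auto_derive; auto; field; lra.
Qed.

Lemma is_derive_right L n c w : 0 < L ->
  (forall x, is_derive (fun y => ppart y ^ n) x (c x)) ->
  is_derive (fun y => ppart (1 - y / L) ^ n) w (- c (1 - w / L) / L).
Proof.
  intros HL H.
  replace (- c (1 - w / L) / L) with ((- / L) * c (1 - w / L)) by (unfold Rdiv; ring).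
  apply (is_derive_comp (fun y => ppart y ^ n) (fun y => 1 - y / L)); auto.
  auto_derive; auto; field; lra.
Qed.

Lemma is_derive_bump L w : 0 < L -> is_derive (bump L) w (bump1 L w).
Proof.
  intros HL; unfold bump.
  pose proof (is_derive_left L 3 _ w HL is_derive_ppart3) as D1.
  pose proof (is_derive_right L 3 _ w HL is_derive_ppart3) as D2.
  pose proof (is_derive_mult _ _ _ _ _ D1 D2 Rmult_comm) as D.
  eapply is_derive_ext; [|eapply (eq_rect _ (is_derive _ w)); [exact D|]].
  - reflexivity.
  - unfold plus, mult; simpl; unfold bump1; field; lra.
Qed.

Lemma is_derive_bump1 L w : 0 < L -> is_derive (bump1 L) w (bump2 L w).
Proof.
  intros HL.
  pose proof (is_derive_left L 3 _ w HL is_derive_ppart3) as A3.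
  pose proof (is_derive_right L 3 _ w HL is_derive_ppart3) as B3.
  pose proof (is_derive_left L 2 _ w HL is_derive_ppart2) as A2.
  pose proof (is_derive_right L 2 _ w HL is_derive_ppart2) as B2.
  pose proof (is_derive_mult _ _ _ _ _ A2 B3 Rmult_comm) as D1.
  pose proof (is_derive_mult _ _ _ _ _ A3 B2 Rmult_comm) as D2.
  pose proof (is_derive_scal _ _ (3 / L) _ (is_derive_minus _ _ _ _ _ D1 D2)) as D.
  eapply is_derive_ext; [|eapply (eq_rect _ (is_derive _ w)); [exact D|]].
  - intros y; match goal with |- ?l = ?r => change (l = r :> R) end; unfold minus, plus, opp, mult; simpl; unfold bump1; field; lra.
  - unfold minus, plus, opp, scal, mult; simpl; unfold mult; simpl; unfold bump2; field; lra.
Qed.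

Lemma continuous_bump2 L w : 0 < L -> continuous (bump2 L) w.
Proof.
  intros HL.
  assert (HA : continuous (fun y => ppart (y / L)) w).
  { apply (continuous_comp (fun y => y / L) ppart); [|apply continuous_ppart].
    apply (ex_derive_continuous (fun y : R => y / L)); auto_derive; auto. }
  assert (HB : continuous (fun y => ppart (1 - y / L)) w).
  { apply (continuous_comp (fun y => 1 - y / L) ppart); [|apply continuous_ppart].
    apply (ex_derive_continuous (fun y : R => 1 - y / L)); auto_derive; auto. }
  pose proof (continuous_mult _ _ _ HA HB) as HP.
  pose proof (continuous_mult _ _ _ HP HP) as HPP.
  pose proof (continuous_plus _ _ _ (continuous_mult _ _ _ HB HB) (continuous_mult _ _ _ HA HA)) as HS.
  pose proof (continuous_scal_r (6 / L ^ 2) _ _ (continuous_mult _ _ _ HP HS)) as H1.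
  pose proof (continuous_scal_r (18 / L ^ 2) _ _ HPP) as H2.
  eapply continuous_ext; [|exact (continuous_minus _ _ _ H1 H2)].
  intros y; match goal with |- ?l = ?r => change (l = r :> R) end; unfold minus, plus, opp, scal, mult; simpl; unfold mult; simpl; unfold bump2; field; lra.
Qed.

Lemma bump_support_cases L w : 0 < L ->
  (w <= 0 \/ L <= w) /\ ppart (w / L) * ppart (1 - w / L) = 0 \/
  0 < w < L /\ ppart (w / L) = w / L /\ ppart (1 - w / L) = 1 - w / L /\
  0 < w / L < 1.
Proof.
  intros HL.
  assert (E : w = w / L * L) by (field; lra).
  destruct (Rle_lt_dec w 0).
  - left; split; auto; rewrite (ppart_0 (w / L)); [ring | nra].
  - destruct (Rle_lt_dec L w).
    + left; split; auto; rewrite (ppart_0 (1 - w / L)); [ring | nra].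
    + right; assert (0 < w / L < 1) by (split; nra).
      rewrite !ppart_eq by lra; lra.
Qed.

Lemma bump_out L w : 0 < L -> w <= 0 \/ L <= w ->
  bump L w = 0 /\ bump1 L w = 0 /\ bump2 L w = 0.
Proof.
  intros HL Hw; destruct (bump_support_cases L w HL) as [[_ E]|H]; [|lra].
  unfold bump, bump1, bump2; rewrite <- Rpow_mult_distr, E; unfold Rdiv; repeat split; ring.
Qed.

Lemma bump_ge0 L w : 0 <= bump L w.
Proof. apply Rmult_le_pos; apply pow_le, ppart_ge0. Qed.

Lemma bump_le L w : 0 < L -> bump L w <= indic (0 < w <= L).
Proof.
  intros HL; destruct (bump_support_cases L w HL) as [[H _]|(H & E1 & E2 & Hs)].
  - destruct (bump_out L w HL H) as [-> _]; apply indic_ge0.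
  - rewrite indic_true by lra; unfold bump; rewrite E1, E2.
    rewrite <- (Rmult_1_r 1); apply Rmult_le_compat; try (apply pow_le; lra);
      rewrite <- (pow1 3); apply pow_incr; lra.
Qed.

(** Each derivative costs one factor [1 / L]. Only this scaling matters, so the constants here and
    in [bump2_le] are crude: [30 = 6 * 2 + 18]. *)
Lemma bump1_le L w : 0 < L -> Rabs (bump1 L w) <= 3 / L * indic (0 < w <= L).
Proof.
  intros HL; destruct (bump_support_cases L w HL) as [[H _]|(H & E1 & E2 & Hs)].
  - destruct (bump_out L w HL H) as [_ [-> _]]; rewrite Rabs_R0.
    apply Rmult_le_pos; [apply Rlt_le, Rdiv_lt_0_compat; lra | apply indic_ge0].
  - rewrite indic_true by lra; unfold bump1; rewrite E1, E2; set (s := w / L) in *.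
    unfold Rdiv; rewrite Rabs_mult, (Rabs_pos_eq (/ L)), Rmult_1_r
      by (apply Rlt_le, Rinv_0_lt_compat; lra).
    apply Rmult_le_compat_r; [apply Rlt_le, Rinv_0_lt_compat; lra|].
    assert (0 <= s * (1 - s) <= 1) by nra; set (q := s * (1 - s)) in *.
    apply Rabs_le; split; nra.
Qed.

Lemma bump2_le L w : 0 < L -> Rabs (bump2 L w) <= 30 / L ^ 2 * indic (0 < w <= L).
Proof.
  intros HL; assert (0 < L ^ 2) by (apply pow_lt; lra).
  destruct (bump_support_cases L w HL) as [[H0 _]|(H0 & E1 & E2 & Hs)].
  - destruct (bump_out L w HL H0) as [_ [_ ->]]; rewrite Rabs_R0.
    apply Rmult_le_pos; [apply Rlt_le, Rdiv_lt_0_compat; lra | apply indic_ge0].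
  - rewrite indic_true by lra; unfold bump2; rewrite E1, E2; set (s := w / L) in *.
    unfold Rdiv; rewrite Rabs_mult, (Rabs_pos_eq (/ L ^ 2)), Rmult_1_r
      by (apply Rlt_le, Rinv_0_lt_compat; lra).
    apply Rmult_le_compat_r; [apply Rlt_le, Rinv_0_lt_compat; lra|].
    assert (0 <= s * (1 - s) <= 1) by nra; set (q := s * (1 - s)) in *.
    assert (0 <= (1 - s) ^ 2 + s ^ 2 <= 2) by nra; set (r := (1 - s) ^ 2 + s ^ 2) in *.
    assert (0 <= q * r <= 2) by nra.
    apply Rabs_le; split; nra.
Qed.

Lemma bump_ge L w : 0 < L -> L / 4 <= w <= 3 * L / 4 -> / 4096 <= bump L w.
Proof.
  intros HL Hw; destruct (bump_support_cases L w HL) as [[H _]|(H & E1 & E2 & Hs)]; [lra|].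
  unfold bump; rewrite E1, E2; rewrite <- Rpow_mult_distr.
  assert (E : w = w / L * L) by (field; lra).
  assert (1 / 4 <= w / L <= 3 / 4) by (split; nra).
  (* On the middle half both factors are at least [1 / 4], so their product is at least [1 / 16]. *)
  replace (/ 4096) with ((/ 16) ^ 3) by field.
  apply pow_incr; split; [lra | nra].
Qed.

(* With [P = ppart (w / L) * ppart (1 - w / L)], AM-GM gives
   [3 A P^2 / L <= a/2 P^3 + 9 A^2 P / (2 a L^2)]. *)
Lemma bump1_amgm L w A a : 0 < L -> 0 <= A -> 0 < a ->
  A * Rabs (bump1 L w) <=
  a / 2 * bump L w + 9 * A ^ 2 / (2 * a * L ^ 2) * indic (0 < w <= L).
Proof.
  intros HL HA Ha; assert (0 < L ^ 2) by (apply pow_lt; lra).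
  assert (HK : 0 <= 9 * A ^ 2 / (2 * a * L ^ 2)).
  { apply Rmult_le_pos; [nra|]; apply Rlt_le, Rinv_0_lt_compat; nra. }
  destruct (bump_support_cases L w HL) as [[H0 _]|(H0 & E1 & E2 & Hs)].
  - destruct (bump_out L w HL H0) as [-> [-> _]]; rewrite Rabs_R0.
    pose proof (indic_ge0 (0 < w <= L)); nra.
  - rewrite indic_true by lra; unfold bump, bump1; rewrite E1, E2; set (s := w / L) in *.
    rewrite <- Rpow_mult_distr.
    assert (0 <= s * (1 - s) <= 1) by nra; set (q := s * (1 - s)) in *.
    assert (HR : Rabs (3 * q ^ 2 * (1 - s - s) / L) <= 3 * q ^ 2 / L).
    { unfold Rdiv; rewrite Rabs_mult, (Rabs_pos_eq (/ L))
        by (apply Rlt_le, Rinv_0_lt_compat; lra).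
      apply Rmult_le_compat_r; [apply Rlt_le, Rinv_0_lt_compat; lra|].
      apply Rabs_le; split; nra. }
    apply Rle_trans with (A * (3 * q ^ 2 / L)); [now apply Rmult_le_compat_l|].
    apply Rle_trans with (a / 2 * q ^ 3 + 9 * A ^ 2 / (2 * a * L ^ 2) * q); [|nra].
    apply Rminus_le_0.
    (* The difference of the two sides is a square times [q / (2 * a)]; completing this square
       dictates the coefficient [9 A^2 / (2 a L^2)]. *)
    replace (_ - _) with (q / (2 * a) * (a * q - 3 * A / L) ^ 2) by (field; lra).
    apply Rmult_le_pos; [|apply pow2_ge_0].
    apply Rmult_le_pos; [lra|]; apply Rlt_le, Rinv_0_lt_compat; lra.
Qed.

(** By the mean value theorem the change is at most [v] times the bound for [bump2], and the window
    of length [L + v] contains both supports. Summed over that window, the cost is of order [1 / L]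
    for fixed [v]. *)
Lemma bump1_shift L w v : 0 < L -> 0 <= v ->
  Rabs (bump1 L (w - v)) <= Rabs (bump1 L w) + 30 / L ^ 2 * v * indic (0 < w <= L + v).
Proof.
  intros HL Hv.
  assert (HK : 0 <= 30 / L ^ 2) by (apply Rlt_le, Rdiv_lt_0_compat; [lra | apply pow_lt; lra]).
  destruct (classic (0 < w <= L + v)) as [Hin|Hout].
  - rewrite (indic_true (0 < w <= L + v)) by auto.
    destruct (MVT_gen (bump1 L) (w - v) w (bump2 L)) as (c & _ & Hc).
    + intros; now apply is_derive_bump1.
    + intros x _; apply continuity_pt_filterlim, (ex_derive_continuous (bump1 L)).
      eexists; now apply is_derive_bump1.
    + pose proof (bump2_le L c HL) as Hb.
      pose proof (indic_le1 (0 < c <= L)).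
      assert (Rabs (bump2 L c) <= 30 / L ^ 2) by nra.
      assert (Rabs (bump1 L w - bump1 L (w - v)) <= 30 / L ^ 2 * v).
      { rewrite Hc, Rabs_mult; replace (w - (w - v)) with v by ring.
        rewrite (Rabs_pos_eq v) by auto; now apply Rmult_le_compat_r. }
      pose proof (Rabs_triang_inv (bump1 L (w - v)) (bump1 L w)).
      rewrite (Rabs_minus_sym (bump1 L (w - v))) in *; lra.
  - rewrite indic_false by auto.
    destruct (bump_out L (w - v) HL) as (_ & -> & _).
    + destruct (Rle_lt_dec w 0); [left; lra | right].
      destruct (Rle_lt_dec w (L + v)); [tauto | lra].
    + rewrite Rabs_R0; pose proof (Rabs_pos (bump1 L w)); lra.
Qed.

(** * The integral of the bump *)

Definition bump_int (L u : R) : R := RInt (bump L) 0 u.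

Lemma continuous_bump L w : 0 < L -> continuous (bump L) w.
Proof.
  intros HL; apply (ex_derive_continuous (bump L)); eexists; now apply is_derive_bump.
Qed.

Lemma continuous_bump1 L w : 0 < L -> continuous (bump1 L) w.
Proof.
  intros HL; apply (ex_derive_continuous (bump1 L)); eexists; now apply is_derive_bump1.
Qed.

Lemma ex_RInt_bump L x y : 0 < L -> ex_RInt (bump L) x y.
Proof. intros HL; apply (ex_RInt_continuous (bump L)); intros; now apply continuous_bump. Qed.

Lemma is_derive_bump_int L u : 0 < L -> is_derive (bump_int L) u (bump L u).
Proof.
  intros HL; apply (is_derive_RInt (bump L) (bump_int L) 0 u).
  - apply filter_forall; intros x; apply (RInt_correct (bump L)); now apply ex_RInt_bump.
  - now apply continuous_bump.
Qed.

Lemma bump_int_0 L : bump_int L 0 = 0.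
Proof. apply (RInt_point 0 (bump L)). Qed.

Lemma bump_int_eq L u : 0 < L -> L <= u -> bump_int L u = bump_int L L.
Proof.
  intros HL Hu; unfold bump_int.
  rewrite <- (RInt_Chasles (bump L) 0 L u) by now apply ex_RInt_bump.
  rewrite (RInt_ext (bump L) (fun _ => 0) L u).
  - rewrite RInt_const; unfold plus, scal; simpl; unfold mult; simpl; ring.
  - intros x Hx; rewrite Rmin_left, Rmax_right in Hx by lra.
    apply bump_out; auto; right; lra.
Qed.

(** The middle half alone contributes at least [L / 8192]. *)
Lemma bump_int_gt0 L : 0 < L -> 0 < bump_int L L.
Proof.
  intros HL; unfold bump_int.
  rewrite <- (RInt_Chasles (bump L) 0 (L / 4) L) by now apply ex_RInt_bump.
  rewrite <- (RInt_Chasles (bump L) (L / 4) (3 * L / 4) L) by now apply ex_RInt_bump.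
  assert (H : forall x y, x <= y -> 0 <= RInt (bump L) x y).
  { intros; apply RInt_ge_0; auto; [now apply ex_RInt_bump | intros; apply bump_ge0]. }
  pose proof (H 0 (L / 4)); pose proof (H (3 * L / 4) L).
  assert (Hm : RInt (fun _ => / 4096) (L / 4) (3 * L / 4) <= RInt (bump L) (L / 4) (3 * L / 4)).
  { apply RInt_le; [lra | apply ex_RInt_const | now apply ex_RInt_bump |].
    intros; apply bump_ge; lra. }
  rewrite RInt_const in Hm; unfold plus, scal in *; simpl in *; unfold mult in *; simpl in *; lra.
Qed.

(** * The smoothed Chebyshev identity *)

Lemma exp_monotone x y : x <= y -> exp x <= exp y.
Proof.
  intros [H| ->]; [left; now apply exp_increasing | right; reflexivity].
Qed.

Lemma is_RInt_zero x y : is_RInt (fun _ => 0) x y 0.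
Proof.
  assert (H := is_RInt_const x y (0 : R)).
  unfold scal in H; simpl in H; unfold mult in H; simpl in H; now rewrite Rmult_0_r in H.
Qed.

Lemma is_RInt_lsum {A} (F : A -> R -> R) (v : A -> R) m x y :
  (forall k, In k m -> is_RInt (F k) x y (v k)) ->
  is_RInt (fun t => lsum (fun k => F k t) m) x y (lsum v m).
Proof.
  induction m as [|k m IH]; intros H; simpl.
  - apply is_RInt_zero.
  - apply (is_RInt_plus (F k)); [apply H | apply IH; intros; apply H]; simpl; auto.
Qed.

Lemma is_RInt_jump (f df : R -> R) n x T :
  x <= n <= T ->
  (forall t, x <= t <= T -> is_derive f t (df t)) ->
  (forall t, x <= t <= T -> continuous df t) ->
  is_RInt (fun t => indic (n < t) * df t) x T (f T - f n).
Proof.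
  intros Hn Hd Hc.
  replace (f T - f n) with (plus 0 (minus (f T) (f n)))
    by (unfold minus, plus, opp, scal; simpl; unfold mult; simpl; ring).
  apply (is_RInt_Chasles (V := R_NormedModule)) with n.
  - apply is_RInt_ext with (fun _ => 0); [|apply is_RInt_zero].
    intros t Ht; rewrite Rmin_left, Rmax_right in Ht by lra.
    rewrite indic_false; lra.
  - apply is_RInt_ext with df.
    + intros t Ht; rewrite Rmin_left, Rmax_right in Ht by lra.
      rewrite indic_true; lra.
    + apply (is_RInt_derive f df); intros t Ht; rewrite Rmin_left, Rmax_right in Ht by lra;
        [apply Hd | apply Hc]; lra.
Qed.

(* Abel summation of [f] against [N(t) = a t + (N(t) - a t)]; [G] is a primitive
   of [t f'(t)]. *)
Lemma remainder_sum p a T l (f df G : R -> R) :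
  beurling_primes p -> is_integers p T l -> 1 <= T ->
  (forall t, 1 <= t <= T -> is_derive f t (df t)) ->
  (forall t, 1 <= t <= T -> continuous df t) ->
  (forall t, 1 <= t <= T -> is_derive G t (t * df t)) ->
  f T = 0 ->
  is_RInt (fun t => (Ncount p t - a * t) * df t) 1 T
    (- lsum (fun s => f (gprod p s)) l - a * (G T - G 1)).
Proof.
  intros Hp Hl HT Hf Hc HG H0.
  apply is_RInt_ext with
    (fun t => minus (lsum (fun s => indic (gprod p s < t) * df t) l) (scal a (t * df t))).
  { intros t Ht; rewrite Rmin_left, Rmax_right in Ht by lra.
    rewrite (Ncount_lsum p T l t Hl) by lra.
    rewrite (lsum_ext _ (fun s => df t * indic (gprod p s < t))) by (intros; ring).
    rewrite lsum_scal; unfold minus, plus, opp, scal; simpl; unfold mult; simpl; ring. }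
  apply (is_RInt_minus (fun t => lsum (fun s => indic (gprod p s < t) * df t) l)
           (fun t => scal a (t * df t)) 1 T _ (scal a (minus (G T) (G 1)))).
  (* Since [f T = 0], the unit step at [n] contributes [f T - f n = - f n]. *)
  - replace (- lsum (fun s => f (gprod p s)) l) with (lsum (fun s => f T - f (gprod p s)) l).
    + apply (is_RInt_lsum (fun s t => indic (gprod p s < t) * df t)).
      intros s Hs; apply Hl in Hs; pose proof (gprod_ge1 p Hp s).
      apply is_RInt_jump; auto; lra.
    + rewrite (lsum_ext _ (fun s => (-1) * f (gprod p s))) by (intros; rewrite H0; ring).
      rewrite lsum_scal; ring.
  - apply (is_RInt_scal (fun t => t * df t)), (is_RInt_derive G (fun t => t * df t));
      intros t Ht; rewrite Rmin_left, Rmax_right in Ht by lra; auto.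
    apply (continuous_mult (fun t : R => t) df); [apply continuous_id | auto].
Qed.

Lemma is_derive_comp_ln (f : R -> R) (df w t : R) : 0 < t ->
  is_derive f (w - ln t) df -> is_derive (fun t => f (w - ln t)) t (- df / t).
Proof.
  intros Ht Hf; replace (- df / t) with (scal (- / t) df)
    by (unfold scal; simpl; unfold mult; simpl; unfold Rdiv; ring).
  apply (is_derive_comp f (fun t => w - ln t)); auto.
  auto_derive; auto; unfold Rdiv; ring.
Qed.

Lemma continuous_comp_ln (f : R -> R) (w t : R) : 0 < t ->
  continuous f (w - ln t) -> continuous (fun t => f (w - ln t)) t.
Proof.
  intros Ht Hf; apply (continuous_comp (fun t => w - ln t) f); auto.
  apply (ex_derive_continuous (fun t : R => w - ln t)); auto_derive; auto.
Qed.

Lemma continuous_inv2 t : 0 < t -> continuous (fun t => / t ^ 2) t.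
Proof.
  intros Ht; apply (ex_derive_continuous (fun t : R => / t ^ 2)); auto_derive; auto.
  nra.
Qed.

Lemma is_derive_eq (f : R -> R) x d d' : is_derive f x d -> d = d' -> is_derive f x d'.
Proof. now intros H <-. Qed.

(** The inner sum of the convolution for one prime power [q], where [w = u - log q]. Because
    [w <= ln T], [bump] and [bump1] vanish at [t = T], and the boundary term at [t = 1], where
    [ln t = 0], is the main term. *)
Lemma bump_sum p a L T l w :
  beurling_primes p -> is_integers p T l -> 1 <= T -> 0 < L -> w <= ln T ->
  is_RInt (fun t => (Ncount p t - a * t) / t / t * (bump1 L (w - ln t) + bump2 L (w - ln t)))
    1 T (lsum (fun s => bump1 L (w - ln (gprod p s)) / gprod p s) l
         - a * (bump L w + bump1 L w)).
Proof.
  intros Hp Hl HT HL Hw.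
  destruct (bump_out L (w - ln T) HL) as (E0 & E1 & _); [left; lra|].
  pose (f := fun t => bump1 L (w - ln t) / t).
  pose (df := fun t => - (bump1 L (w - ln t) + bump2 L (w - ln t)) * / t ^ 2).
  pose (G := fun t => bump1 L (w - ln t) + bump L (w - ln t)).
  assert (H : is_RInt (fun t => (Ncount p t - a * t) * df t) 1 T
    (- lsum (fun s => f (gprod p s)) l - a * (G T - G 1))).
  { apply remainder_sum; auto.
    - intros t Ht; unfold f, df, Rdiv.
      assert (D1 := is_derive_comp_ln _ _ w t ltac:(lra) (is_derive_bump1 L (w - ln t) HL)).
      assert (D2 : is_derive (fun t => / t) t (- / t ^ 2)).
      { auto_derive; [lra|]; field; lra. }
      eapply is_derive_eq; [exact (is_derive_mult _ _ _ _ _ D1 D2 Rmult_comm)|].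
      unfold plus, mult; simpl; field; lra.
    - intros t Ht; unfold df.
      apply (continuous_mult (fun t => - (bump1 L (w - ln t) + bump2 L (w - ln t))) (fun t => / t ^ 2));
        [|apply continuous_inv2; lra].
      apply (continuous_opp (fun t => bump1 L (w - ln t) + bump2 L (w - ln t))).
      apply (continuous_plus (fun t => bump1 L (w - ln t)) (fun t => bump2 L (w - ln t)));
        apply continuous_comp_ln; try lra; [now apply continuous_bump1 | now apply continuous_bump2].
    - intros t Ht; unfold G, df.
      assert (D1 := is_derive_comp_ln _ _ w t ltac:(lra) (is_derive_bump1 L (w - ln t) HL)).
      assert (D2 := is_derive_comp_ln _ _ w t ltac:(lra) (is_derive_bump L (w - ln t) HL)).
      eapply is_derive_eq; [exact (is_derive_plus _ _ _ _ _ D1 D2)|].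
      unfold plus; simpl; field; lra.
    - unfold f; rewrite E1; unfold Rdiv; ring. }
  apply (is_RInt_ext (fun t => opp ((Ncount p t - a * t) * df t))).
  - intros t Ht; rewrite Rmin_left, Rmax_right in Ht by lra.
    unfold df, opp; simpl; field; lra.
  - replace (_ - _) with (opp (- lsum (fun s => f (gprod p s)) l - a * (G T - G 1)));
      [now apply (is_RInt_opp (fun t => (Ncount p t - a * t) * df t))|].
    unfold G, opp; simpl; rewrite E0, E1, ln_1, Rminus_0_r; unfold f; ring.
Qed.

(** The sum called [J(u)] in the overview. *)
Definition log_sum p L u l : R :=
  lsum (fun s => ln (gprod p s) * (bump1 L (u - ln (gprod p s)) / gprod p s)) l.

(** Abel summation applied directly to [J(u)], with the weight [ln t] kept inside the test function;
    this isolates the main term [a * bump_int L u]. *)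
Lemma log_bump_sum p a L u l :
  beurling_primes p -> is_integers p (exp u) l -> 0 <= u -> 0 < L ->
  is_RInt (fun t => (Ncount p t - a * t) *
      ((bump1 L (u - ln t) - ln t * (bump1 L (u - ln t) + bump2 L (u - ln t))) * / t ^ 2))
    1 (exp u) (a * bump_int L u - log_sum p L u l).
Proof.
  intros Hp Hl Hu HL.
  assert (HT : 1 <= exp u) by (rewrite <- exp_0; apply exp_monotone; lra).
  destruct (bump_out L (u - ln (exp u)) HL) as (E0 & E1 & _); [left; rewrite ln_exp; lra|].
  pose (f := fun t => ln t * (bump1 L (u - ln t) / t)).
  pose (df := fun t => (bump1 L (u - ln t) - ln t * (bump1 L (u - ln t) + bump2 L (u - ln t))) * / t ^ 2).
  (* Differentiating the product with [ln t] leaves an extra [bump / t], which the [bump_int] term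
     cancels; at [t = 1] only that term survives. *)
  pose (G := fun t => ln t * (bump1 L (u - ln t) + bump L (u - ln t)) + bump_int L (u - ln t)).
  assert (H : is_RInt (fun t => (Ncount p t - a * t) * df t) 1 (exp u)
    (- lsum (fun s => f (gprod p s)) l - a * (G (exp u) - G 1))).
  { apply remainder_sum; auto.
    - intros t Ht; unfold f, df.
      assert (D0 : is_derive (fun t => ln t) t (/ t)) by (apply is_derive_Reals, derivable_pt_lim_ln; lra).
      assert (D1 := is_derive_comp_ln _ _ u t ltac:(lra) (is_derive_bump1 L (u - ln t) HL)).
      assert (D2 : is_derive (fun t => / t) t (- / t ^ 2)).
      { auto_derive; [lra|]; field; lra. }
      eapply is_derive_eq; [exact (is_derive_mult _ _ _ _ _ D0
        (is_derive_mult _ _ _ _ _ D1 D2 Rmult_comm) Rmult_comm)|].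
      unfold plus, mult; simpl; field; lra.
    - intros t Ht; unfold df.
      assert (C1 := continuous_comp_ln _ u t ltac:(lra) (continuous_bump1 L (u - ln t) HL)).
      assert (C2 := continuous_comp_ln _ u t ltac:(lra) (continuous_bump2 L (u - ln t) HL)).
      (* As [- (0 - ln t)] is [ln t], this is the continuity of the logarithm. *)
      assert (C0 := continuous_comp_ln (fun x => - x) 0 t ltac:(lra)
                      (continuous_opp _ _ (continuous_id _))).
      eapply continuous_ext; [|exact (continuous_mult _ _ _ (continuous_minus _ _ _ C1
        (continuous_mult _ _ _ C0 (continuous_plus _ _ _ C1 C2))) (continuous_inv2 t ltac:(lra)))].
      intros x; unfold minus, plus, opp, mult; simpl; ring.
    - intros t Ht; unfold G, df.
      assert (D0 : is_derive (fun t => ln t) t (/ t)) by (apply is_derive_Reals, derivable_pt_lim_ln; lra).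
      assert (D1 := is_derive_comp_ln _ _ u t ltac:(lra) (is_derive_bump1 L (u - ln t) HL)).
      assert (D2 := is_derive_comp_ln _ _ u t ltac:(lra) (is_derive_bump L (u - ln t) HL)).
      assert (D3 := is_derive_comp_ln _ _ u t ltac:(lra) (is_derive_bump_int L (u - ln t) HL)).
      eapply is_derive_eq; [exact (is_derive_plus _ _ _ _ _
        (is_derive_mult _ _ _ _ _ D0 (is_derive_plus _ _ _ _ _ D1 D2) Rmult_comm) D3)|].
      unfold plus, mult; simpl; field; lra.
    - unfold f; rewrite E1; unfold Rdiv; ring. }
  replace (_ - _) with (- lsum (fun s => f (gprod p s)) l - a * (G (exp u) - G 1)); [exact H|].
  unfold G; rewrite E0, E1, ln_1, ln_exp, Rminus_diag, bump_int_0.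
  rewrite Rminus_0_r; unfold f, log_sum; ring.
Qed.

Lemma RInt_split_bound (f g1 g2 : R -> R) x y z v G1 G2 :
  x <= y <= z -> is_RInt f x z v ->
  (forall t, x <= t <= y -> Rabs (f t) <= g1 t) -> is_RInt g1 x y G1 ->
  (forall t, y <= t <= z -> Rabs (f t) <= g2 t) -> is_RInt g2 y z G2 ->
  Rabs v <= G1 + G2.
Proof.
  intros Hxyz Hf H1 HG1 H2 HG2.
  assert (Hex : ex_RInt f x z) by now exists v.
  destruct (ex_RInt_Chasles_1 f x y z Hxyz Hex) as [v1 Hv1].
  destruct (ex_RInt_Chasles_2 f x y z Hxyz Hex) as [v2 Hv2].
  pose proof (is_RInt_unique _ _ _ _ Hf) as E.
  rewrite (is_RInt_unique _ _ _ _ (is_RInt_Chasles _ _ _ _ _ _ Hv1 Hv2)) in E; subst v.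
  assert (N1 := norm_RInt_le f g1 x y v1 G1 (proj1 Hxyz) H1 Hv1 HG1).
  assert (N2 := norm_RInt_le f g2 y z v2 G2 (proj2 Hxyz) H2 Hv2 HG2).
  unfold norm in N1, N2; simpl in N1, N2; unfold abs in N1, N2; simpl in N1, N2.
  unfold plus; simpl; eapply Rle_trans; [apply Rabs_triang | lra].
Qed.

Definition log_remainder p a : Prop :=
  forall eps, 0 < eps -> exists X, forall x, X <= x ->
    Rabs (Ncount p x - a * x) <= eps * (x / ln x).

(** The integrand lives on [u - L <= ln t <= u]. There the kernel is at most [K ln t / t^2] and the
    remainder at most a small multiple of [t / ln t], so the product is a small multiple of [1 / t],
    whose integral over this window is [L]. *)
Lemma log_sum_asymptotic p a L eps :
  beurling_primes p -> log_remainder p a -> 0 < L -> 0 < eps ->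
  exists u0, forall u l, u0 <= u -> is_integers p (exp u) l ->
    Rabs (a * bump_int L L - log_sum p L u l) <= eps.
Proof.
  intros Hp HN HL Heps.
  (* From the bounds on [bump1] and [bump2]: [3 / L + (3 / L + 30 / L^2) ln t <= K ln t] once
     [ln t >= 1]. *)
  pose (K := 6 / L + 30 / L ^ 2).
  assert (HL1 : 0 < / L) by now apply Rinv_0_lt_compat.
  assert (HL2 : 0 < / L ^ 2) by (apply Rinv_0_lt_compat, pow_lt; lra).
  assert (HK : 0 < K) by (unfold K, Rdiv; lra).
  destruct (HN (eps / (K * L))) as [X HX]; [apply Rdiv_lt_0_compat; nra|].
  (* This threshold gives both [ln t >= 1] and [t >= X] on the whole window. *)
  exists (L + 1 + Rabs X); intros u l Hu Hl.
  pose proof (Rle_abs X); pose proof (Rabs_pos X).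
  assert (HX' : X <= exp (u - L)) by (pose proof (exp_ineq1_le (u - L)); lra).
  rewrite <- (bump_int_eq L u) by lra.
  assert (H1 : 1 <= exp (u - L)) by (rewrite <- exp_0; apply exp_monotone; lra).
  assert (H2 : exp (u - L) <= exp u) by (apply exp_monotone; lra).
  assert (HI : is_RInt (fun t => eps / (K * L) * K * / t) (exp (u - L)) (exp u)
                 (eps / (K * L) * K * (ln (exp u) - ln (exp (u - L))))).
  { apply (is_RInt_scal (fun t => / t)).
    apply (is_RInt_derive ln (fun t => / t)); intros t Ht;
      rewrite Rmin_left, Rmax_right in Ht by lra.
    - apply is_derive_Reals, derivable_pt_lim_ln; lra.
    - apply (ex_derive_continuous (fun t : R => / t)); auto_derive; lra. }
  assert (HI0 : is_RInt (fun _ => 0) 1 (exp (u - L)) 0) by apply is_RInt_zero.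
  rewrite !ln_exp in HI.
  eapply Rle_trans; [refine (RInt_split_bound _ _ _ _ _ _ _ _ _ (conj H1 H2)
    (log_bump_sum p a L u l Hp Hl _ HL) _ HI0 _ HI)|]; [lra| | |].
  all: try (intros t Ht; assert (0 < t) by lra).
  - assert (ln t <= u - L) by (rewrite <- (ln_exp (u - L)); apply ln_le; lra).
    destruct (bump_out L (u - ln t) HL) as (_ & -> & ->); [right; lra|].
    apply Req_le; replace (_ * _) with 0 by ring; apply Rabs_R0.
  - assert (Hlt : u - L <= ln t) by (rewrite <- (ln_exp (u - L)); apply ln_le; lra).
    assert (HR := HX t ltac:(lra)).
    assert (B1 := bump1_le L (u - ln t) HL); assert (B2 := bump2_le L (u - ln t) HL).
    assert (Hi := indic_le1 (0 < u - ln t <= L)); set (i := indic _) in *.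
    set (b1 := bump1 L (u - ln t)) in *; set (b2 := bump2 L (u - ln t)) in *.
    assert (B1' : Rabs b1 <= 3 / L) by (unfold Rdiv in *; nra).
    assert (B2' : Rabs b2 <= 30 / L ^ 2) by (unfold Rdiv in *; nra).
    assert (B : Rabs (b1 - ln t * (b1 + b2)) <= K * ln t).
    { unfold Rminus; eapply Rle_trans; [apply Rabs_triang|].
      rewrite Rabs_Ropp, Rabs_mult, (Rabs_pos_eq (ln t)) by lra.
      pose proof (Rabs_triang b1 b2); unfold K; unfold Rdiv in *; nra. }
    rewrite !Rabs_mult, (Rabs_pos_eq (/ t ^ 2)) by (apply Rlt_le, Rinv_0_lt_compat, pow_lt; lra).
    apply Rle_trans with (eps / (K * L) * (t / ln t) * (K * ln t * / t ^ 2)).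
    + apply Rmult_le_compat; auto; try apply Rabs_pos.
      * apply Rmult_le_pos; [apply Rabs_pos | apply Rlt_le, Rinv_0_lt_compat, pow_lt; lra].
      * apply Rmult_le_compat_r; [apply Rlt_le, Rinv_0_lt_compat, pow_lt; lra | auto].
    + apply Req_le; field; repeat split; lra.
  - apply Req_le; field; lra.
Qed.

(** The sum [S[h](s)] of the overview, over a fixed list [m], so that one finite list serves every
    shift [s = u - ln t]. *)
Definition psum p (m : list (nat * nat)) (th : R -> R) (s : R) : R :=
  lsum (fun kj => ln (p (fst kj)) / p (fst kj) ^ snd kj *
                  th (s - ln (p (fst kj) ^ snd kj))) m.

(** The convolution splits [J(u)] into one sum over [n] for each prime power [q]. Evaluating it by
    [bump_sum] at [w = u - log q], weighting by [Lambda(q) / q] and adding up gives the identity. *)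
Lemma log_sum_identity p a L u l m :
  beurling_primes p -> is_integers p (exp u) l -> is_prime_powers p (exp u) m ->
  0 <= u -> 0 < L ->
  is_RInt (fun t => (Ncount p t - a * t) / t / t *
      (psum p m (bump1 L) (u - ln t) + psum p m (bump2 L) (u - ln t)))
    1 (exp u) (log_sum p L u l - a * (psum p m (bump L) u + psum p m (bump1 L) u)).
Proof.
  intros Hp Hl Hm Hu HL.
  assert (HT : 1 <= exp u) by (rewrite <- exp_0; apply exp_monotone; lra).
  assert (Hq : forall k j, 1 <= p k ^ j)
    by (intros; apply pow_R1_Rle; destruct (prime_gt1 p Hp k); lra).
  apply is_RInt_ext with (fun t => lsum (fun kj => scal (ln (p (fst kj)) / p (fst kj) ^ snd kj)
     ((Ncount p t - a * t) / t / t *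
       (bump1 L (u - ln (p (fst kj) ^ snd kj) - ln t) +
        bump2 L (u - ln (p (fst kj) ^ snd kj) - ln t)))) m).
  { intros t _; unfold psum; rewrite <- lsum_plus, <- lsum_scal; apply lsum_ext; intros [k j] _.
    unfold scal; simpl; unfold mult; simpl.
    replace (u - ln (p k ^ j) - ln t) with (u - ln t - ln (p k ^ j)) by ring; ring. }
  unfold log_sum.
  rewrite (log_convolution p (exp u) l m (fun x => bump1 L (u - ln x) / x) Hp Hl Hm).
  - unfold psum; rewrite <- lsum_plus, <- lsum_scal.
    (* The double change of sign turns the subtracted sum into an added one, so that both merge into
       one sum over [m]. *)
    rewrite (lsum_ext (fun x => a * _) (fun x => (-1) * (- (a * (ln (p (fst x)) / p (fst x) ^ snd x * bump L (u - ln (p (fst x) ^ snd x)) +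
   ln (p (fst x)) / p (fst x) ^ snd x * bump1 L (u - ln (p (fst x) ^ snd x))))))) by (intros; ring).
    rewrite lsum_scal.
    match goal with |- is_RInt _ _ _ (?x - (-1) * ?y) => replace (x - (-1) * y) with (x + y) by ring end.
    rewrite <- lsum_plus.
    rewrite (lsum_ext _ (fun kj => scal (ln (p (fst kj)) / p (fst kj) ^ snd kj)
      (lsum (fun s => bump1 L (u - ln (p (fst kj) ^ snd kj) - ln (gprod p s)) / gprod p s) l
       - a * (bump L (u - ln (p (fst kj) ^ snd kj)) + bump1 L (u - ln (p (fst kj) ^ snd kj)))))).
    + apply is_RInt_lsum; intros [k j] _; apply (is_RInt_scal (V := R_NormedModule)).
      apply bump_sum; auto; rewrite ln_exp; simpl.
      pose proof (ln_le 1 (p k ^ j) ltac:(lra) (Hq k j)) as H; rewrite ln_1 in H; lra.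
    + intros [k j] _; simpl fst; simpl snd; unfold scal; simpl; unfold mult; simpl.
      specialize (Hq k j).
      rewrite (lsum_ext _ (fun s => / p k ^ j *
        (bump1 L (u - ln (p k ^ j) - ln (gprod p s)) / gprod p s))).
      * rewrite lsum_scal; unfold Rdiv; ring.
      * intros s _; pose proof (gprod_ge1 p Hp s); rewrite ln_mult by lra.
        replace (u - (ln (p k ^ j) + ln (gprod p s))) with (u - ln (p k ^ j) - ln (gprod p s)) by ring.
        field; lra.
  - intros x Hx; destruct (bump_out L (u - ln x) HL) as (_ & -> & _).
    + left; pose proof (ln_le (exp u) x (exp_pos u) Hx) as H; rewrite ln_exp in H; lra.
    + unfold Rdiv; ring.
Qed.

(** * Chebyshev bounds *)

Definition phi p b : R := psi p (exp b) / exp b.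

Lemma ln_prime_ge0 p k : beurling_primes p -> 0 <= ln (p k).
Proof.
  intros Hp; destruct (prime_gt1 p Hp k); rewrite <- ln_1; apply ln_le; lra.
Qed.

Lemma prime_power_ge1 p k j : beurling_primes p -> 1 <= p k ^ j.
Proof. intros Hp; apply pow_R1_Rle; destruct (prime_gt1 p Hp k); lra. Qed.

Lemma prime_power_weight_ge0 p k j : beurling_primes p -> 0 <= ln (p k) / p k ^ j.
Proof.
  intros Hp; apply Rmult_le_pos; [now apply ln_prime_ge0|].
  apply Rlt_le, Rinv_0_lt_compat; pose proof (prime_power_ge1 p k j Hp); lra.
Qed.

Lemma psum_le p m th1 th2 s : beurling_primes p ->
  (forall w, th1 w <= th2 w) -> psum p m th1 s <= psum p m th2 s.
Proof.
  intros Hp H; apply lsum_le; intros [k j] _.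
  apply Rmult_le_compat_l; auto; now apply prime_power_weight_ge0.
Qed.

Lemma psum_plus p m th1 th2 s :
  psum p m (fun w => th1 w + th2 w) s = psum p m th1 s + psum p m th2 s.
Proof. unfold psum; rewrite <- lsum_plus; apply lsum_ext; intros; ring. Qed.

Lemma psum_scal p m c th s : psum p m (fun w => c * th w) s = c * psum p m th s.
Proof. unfold psum; rewrite <- lsum_scal; apply lsum_ext; intros; ring. Qed.

Lemma psum_shift p m th s v : psum p m th (s - v) = psum p m (fun w => th (w - v)) s.
Proof. unfold psum; apply lsum_ext; intros; do 2 f_equal; ring. Qed.

Lemma psum_ge0 p m th s : beurling_primes p ->
  (forall w, 0 <= th w) -> 0 <= psum p m th s.
Proof.
  intros Hp H; apply lsum_ge0; intros [k j] _.
  apply Rmult_le_pos; auto; now apply prime_power_weight_ge0.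
Qed.

Lemma psum_abs p m th s : beurling_primes p ->
  Rabs (psum p m th s) <= psum p m (fun w => Rabs (th w)) s.
Proof.
  intros Hp; eapply Rle_trans; [apply lsum_abs|]; apply Req_le, lsum_ext; intros [k j] _.
  rewrite Rabs_mult, (Rabs_pos_eq (ln _ / _)); auto; now apply prime_power_weight_ge0.
Qed.

(** In the window [q >= e^(s-1)], hence [1 / q <= e^(1-s)], and [q < e^s], so that [q] is counted by
    [psi (e^s)]. *)
Lemma psum_unit_window p u m s :
  beurling_primes p -> is_prime_powers p (exp u) m -> s <= u ->
  psum p m (fun w => indic (0 < w <= 1)) s <= exp 1 * phi p s.
Proof.
  intros Hp Hm Hs; unfold phi.
  rewrite (psi_lsum p (exp u) m (exp s) Hm) by now apply exp_monotone.
  replace (exp 1 * (_ / exp s)) with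
    (exp (1 - s) * lsum (fun kj => indic (p (fst kj) ^ snd kj < exp s) * ln (p (fst kj))) m).
  2: { unfold Rminus; rewrite exp_plus, exp_Ropp; unfold Rdiv; ring. }
  rewrite <- lsum_scal; apply lsum_le; intros [k j] _; simpl fst; simpl snd.
  pose proof (prime_power_ge1 p k j Hp) as Hq; set (q := p k ^ j) in *.
  pose proof (ln_prime_ge0 p k Hp); pose proof (exp_pos (1 - s)).
  destruct (classic (0 < s - ln q <= 1)) as [Hw|Hw].
  - rewrite !indic_true; auto.
    + unfold Rdiv; rewrite Rmult_1_r, Rmult_1_l, Rmult_comm.
      apply Rmult_le_compat_r; auto.
      replace (1 - s) with (- (s - 1)) by ring; rewrite exp_Ropp.
      apply Rinv_le_contravar; [apply exp_pos|].
      rewrite <- (exp_ln q) by lra; apply exp_monotone; lra.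
    + rewrite <- (exp_ln q) by lra; apply exp_increasing; lra.
  - rewrite indic_false by auto; rewrite Rmult_0_r.
    apply Rmult_le_pos; [lra|]; apply Rmult_le_pos; [apply indic_ge0 | auto].
Qed.

(** The window is cut into unit windows, the last of which is the unit window at [s - n]. Lengths
    [L] and [V] are natural numbers in the sequel so that they can be counted in this way. *)
Lemma psum_window p u m s B n :
  beurling_primes p -> is_prime_powers p (exp u) m ->
  (forall v, v <= u -> phi p v <= B) -> s <= u ->
  psum p m (fun w => indic (0 < w <= INR n)) s <= INR n * (exp 1 * B).
Proof.
  intros Hp Hm HB Hs; pose proof (exp_pos 1).
  induction n as [|n IH].
  - unfold psum; rewrite (lsum_ext _ (fun _ => 0)); [rewrite lsum_0; simpl; lra|].
    intros; rewrite indic_false; [ring | simpl; lra].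
  - apply Rle_trans with (psum p m (fun w => indic (0 < w <= INR n) + indic (0 < w - INR n <= 1)) s).
    + apply psum_le; auto; intros w; rewrite S_INR.
      destruct (classic (0 < w <= INR n)).
      * rewrite (indic_true (0 < w <= INR n)) by auto.
        pose proof (indic_le1 (0 < w <= INR n + 1)); pose proof (indic_ge0 (0 < w - INR n <= 1)); lra.
      * rewrite (indic_false (0 < w <= INR n)) by auto; rewrite Rplus_0_l.
        apply indic_le; intros [? ?]; destruct (Rle_lt_dec w (INR n)); [tauto | lra].
    + rewrite psum_plus, <- (psum_shift p m (fun w => indic (0 < w <= 1))), S_INR.
      pose proof (pos_INR n).
      assert (H1 := psum_unit_window p u m (s - INR n) Hp Hm ltac:(lra)).
      assert (H2 := HB (s - INR n) ltac:(lra)); nra.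
Qed.

(** For [e^(b-1) <= q < e^b] the point [u - ln q] lies between [L / 4] and [L / 4 + 1], inside the
    middle half because [L >= 2]; there the bump is at least [1 / 4096], and [1 / q >= e^(-b)]. *)
Lemma psum_bump_window p u m L b :
  beurling_primes p -> is_prime_powers p (exp u) m -> 2 <= L -> u = b + L / 4 ->
  / 4096 * (phi p b - exp (-1) * phi p (b - 1)) <= psum p m (bump L) u.
Proof.
  intros Hp Hm HL Hu.
  assert (Hb : exp b <= exp u) by (apply exp_monotone; lra).
  assert (Hb1 : exp (b - 1) < exp b) by (apply exp_increasing; lra).
  unfold phi; rewrite (psi_lsum p (exp u) m (exp b) Hm), (psi_lsum p (exp u) m (exp (b - 1)) Hm) by lra.
  replace (exp (-1) * _) with
   (lsum (fun kj => indic (p (fst kj) ^ snd kj < exp (b - 1)) * ln (p (fst kj))) m / exp b).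
  2: { replace (b - 1) with (b + -1) by ring; rewrite exp_plus; field; split; apply Rgt_not_eq, exp_pos. }
  match goal with |- / 4096 * (?x / _ - ?y / _) <= _ =>
    replace (/ 4096 * (x / exp b - y / exp b)) with (/ 4096 * / exp b * x + (- (/ 4096 * / exp b)) * y)
      by (unfold Rdiv; ring) end.
  rewrite <- !lsum_scal, <- lsum_plus; apply lsum_le; intros [k j] _; simpl fst; simpl snd.
  pose proof (prime_power_ge1 p k j Hp) as Hq; set (q := p k ^ j) in *.
  pose proof (ln_prime_ge0 p k Hp) as Hl; pose proof (exp_pos b).
  assert (Hw : 0 <= ln (p k) / q) by now apply prime_power_weight_ge0.
  destruct (Rlt_le_dec q (exp (b - 1))) as [H1|H1].
  - rewrite !indic_true by lra.
    pose proof (Rmult_le_pos _ _ Hw (bump_ge0 L (u - ln q))); lra.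
  - rewrite (indic_false (q < exp (b - 1))) by lra.
    destruct (Rlt_le_dec q (exp b)) as [H2|H2].
    + rewrite indic_true by auto; rewrite Rmult_0_l, Rmult_0_r, Rplus_0_r, Rmult_1_l.
      assert (ln q < b) by (rewrite <- (ln_exp b); apply ln_increasing; lra).
      assert (b - 1 <= ln q) by (rewrite <- (ln_exp (b - 1)); apply ln_le; [apply exp_pos | lra]).
      assert (HB := bump_ge L (u - ln q) ltac:(lra) ltac:(lra)).
      apply Rle_trans with (ln (p k) / q * / 4096); [|now apply Rmult_le_compat_l].
      assert (/ exp b <= / q) by (apply Rinv_le_contravar; lra).
      unfold Rdiv; nra.
    + rewrite indic_false by lra.
      pose proof (Rmult_le_pos _ _ Hw (bump_ge0 L (u - ln q))); lra.
Qed.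

(** * The integrable remainder and the error terms *)

Definition rho p a t : R := Rabs ((Ncount p t - a * t) / t) / t.

Lemma rho_ge0 p a t : 0 < t -> 0 <= rho p a t.
Proof.
  intros Ht; apply Rmult_le_pos; [apply Rabs_pos | now apply Rlt_le, Rinv_0_lt_compat].
Qed.

Definition rho_integrable p a C : Prop :=
  forall T, 1 <= T -> ex_RInt (rho p a) 1 T /\ RInt (rho p a) 1 T <= C.

Lemma exp_INR_ge1 V : 1 <= exp (INR V).
Proof. rewrite <- exp_0; apply exp_monotone, pos_INR. Qed.

Lemma rho_ex_RInt p a C x y :
  rho_integrable p a C -> 1 <= x <= y -> ex_RInt (rho p a) x y.
Proof.
  intros H Hxy; apply (ex_RInt_Chasles_2 (rho p a)) with 1; [auto | apply H; lra].
Qed.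

(** The partial integrals of a nonnegative function are nondecreasing and bounded, so beyond a point
    [T0] where they come within [eps] of their supremum nothing more than [eps] is left. *)
Lemma rho_tail p a C eps :
  rho_integrable p a C -> 0 < eps ->
  exists V : nat, forall T, exp (INR V) <= T -> RInt (rho p a) (exp (INR V)) T <= eps.
Proof.
  intros H Heps.
  destruct (completeness (fun y => exists T, 1 <= T /\ y = RInt (rho p a) 1 T)) as [S [HS HS']].
  - exists C; intros y (T & HT & ->); now apply H.
  - exists (RInt (rho p a) 1 1), 1; split; [lra | auto].
  - destruct (classic (exists T, 1 <= T /\ S - eps < RInt (rho p a) 1 T)) as [(T0 & HT0 & HT0')|Hn].
    + destruct (INR_unbounded T0) as [V HV]; exists V; intros T HT.
      pose proof (exp_ineq1_le (INR V)) as He.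
      assert (E1 := RInt_Chasles (rho p a) 1 T0 (exp (INR V))
        (rho_ex_RInt p a C 1 T0 H ltac:(lra)) (rho_ex_RInt p a C T0 (exp (INR V)) H ltac:(lra))).
      assert (E2 := RInt_Chasles (rho p a) 1 (exp (INR V)) T
        (rho_ex_RInt p a C 1 (exp (INR V)) H ltac:(lra)) (rho_ex_RInt p a C (exp (INR V)) T H ltac:(lra))).
      unfold plus in E1, E2; simpl in E1, E2.
      assert (0 <= RInt (rho p a) T0 (exp (INR V))).
      { apply RInt_ge_0; [lra | apply (rho_ex_RInt p a C); auto; lra |].
        intros; apply rho_ge0; lra. }
      assert (RInt (rho p a) 1 T <= S) by (apply HS; exists T; split; [lra | auto]).
      lra.
    + exfalso; assert (S <= S - eps); [|lra].
      apply HS'; intros y (T & HT & ->); apply Rnot_lt_le; intros Hlt; apply Hn; now exists T.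
Qed.

(** The window length [L] cancels the factor [1 / L] of the first derivative, so this bound does not
    improve with [L]; for [bump2] one factor [1 / L] remains. *)
Lemma psum_bump1_le p u m B L s :
  beurling_primes p -> is_prime_powers p (exp u) m ->
  (forall v, v <= u -> phi p v <= B) -> s <= u -> (1 <= L)%nat ->
  Rabs (psum p m (bump1 (INR L)) s) <= 3 * (exp 1 * B).
Proof.
  intros Hp Hm HB Hs HL; assert (H1 : 1 <= INR L) by (apply (le_INR 1); auto).
  eapply Rle_trans; [now apply psum_abs|].
  eapply Rle_trans; [apply (psum_le p m _ (fun w => 3 / INR L * indic (0 < w <= INR L)) s Hp)|].
  - intros w; apply bump1_le; lra.
  - rewrite psum_scal.
    replace (3 * (exp 1 * B)) with (3 / INR L * (INR L * (exp 1 * B))) by (field; lra).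
    apply Rmult_le_compat_l; [apply Rlt_le, Rdiv_lt_0_compat; lra | now apply (psum_window p u)].
Qed.

Lemma psum_bump2_le p u m B L s :
  beurling_primes p -> is_prime_powers p (exp u) m ->
  (forall v, v <= u -> phi p v <= B) -> s <= u -> (1 <= L)%nat ->
  Rabs (psum p m (bump2 (INR L)) s) <= 30 / INR L * (exp 1 * B).
Proof.
  intros Hp Hm HB Hs HL; assert (H1 : 1 <= INR L) by (apply (le_INR 1); auto).
  eapply Rle_trans; [now apply psum_abs|].
  eapply Rle_trans; [apply (psum_le p m _ (fun w => 30 / INR L ^ 2 * indic (0 < w <= INR L)) s Hp)|].
  - intros w; apply bump2_le; lra.
  - rewrite psum_scal.
    replace (30 / INR L * (exp 1 * B)) with (30 / INR L ^ 2 * (INR L * (exp 1 * B))) by (field; lra).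
    apply Rmult_le_compat_l; [apply Rlt_le, Rdiv_lt_0_compat; [lra | apply pow_lt; lra]
                             | now apply (psum_window p u)].
Qed.

(** For bounded shifts the sum at [u - v] is brought back to the single quantity [S[|g'|](u)], which
    AM-GM can absorb; the rest is of order [1 / L] for fixed [V]. *)
Lemma psum_bump1_shift_le p u m B L V v :
  beurling_primes p -> is_prime_powers p (exp u) m ->
  (forall v, v <= u -> phi p v <= B) -> (1 <= L)%nat -> 0 <= v <= INR V ->
  Rabs (psum p m (bump1 (INR L)) (u - v)) <=
  psum p m (fun w => Rabs (bump1 (INR L) w)) u
  + 30 / INR L ^ 2 * INR V * ((INR L + INR V) * (exp 1 * B)).
Proof.
  intros Hp Hm HB HL Hv; assert (H1 : 1 <= INR L) by (apply (le_INR 1); auto).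
  assert (HK : 0 <= 30 / INR L ^ 2) by (apply Rlt_le, Rdiv_lt_0_compat; [lra | apply pow_lt; lra]).
  rewrite psum_shift; eapply Rle_trans; [now apply psum_abs|].
  eapply Rle_trans; [apply (psum_le p m _ (fun w => Rabs (bump1 (INR L) w) +
     30 / INR L ^ 2 * INR V * indic (0 < w <= INR (L + V))) u Hp)|].
  - intros w; eapply Rle_trans; [apply bump1_shift; lra|].
    apply Rplus_le_compat_l; apply Rmult_le_compat.
    + apply Rmult_le_pos; lra.
    + apply indic_ge0.
    + apply Rmult_le_compat_l; lra.
    + apply indic_le; rewrite plus_INR; lra.
  - rewrite psum_plus, psum_scal; apply Rplus_le_compat_l.
    rewrite <- plus_INR; apply Rmult_le_compat_l.
    + apply Rmult_le_pos; [lra | apply pos_INR].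
    + apply (psum_window p u); auto; lra.
Qed.

(* Splits the integral of [log_sum_identity] at [exp V]. *)
Lemma log_sum_error p a C eps V L u l m K1 K2 :
  beurling_primes p -> is_integers p (exp u) l -> is_prime_powers p (exp u) m ->
  rho_integrable p a C ->
  (forall T, exp (INR V) <= T -> RInt (rho p a) (exp (INR V)) T <= eps) ->
  0 < L -> INR V <= u -> 0 <= K1 -> 0 <= K2 ->
  (forall v, 0 <= v <= INR V ->
     Rabs (psum p m (bump1 L) (u - v)) + Rabs (psum p m (bump2 L) (u - v)) <= K1) ->
  (forall v, INR V <= v <= u ->
     Rabs (psum p m (bump1 L) (u - v)) + Rabs (psum p m (bump2 L) (u - v)) <= K2) ->
  Rabs (log_sum p L u l - a * (psum p m (bump L) u + psum p m (bump1 L) u))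
  <= K1 * C + K2 * eps.
Proof.
  intros Hp Hl Hm HC Heps HL HV HK1 HK2 H1 H2.
  pose proof (pos_INR V); pose proof (exp_INR_ge1 V) as HV1.
  assert (HVu : exp (INR V) <= exp u) by now apply exp_monotone.
  assert (I := log_sum_identity p a L u l m Hp Hl Hm ltac:(lra) HL).
  destruct (HC _ HV1) as [E1 B1].
  assert (E2 := rho_ex_RInt p a C _ _ HC (conj HV1 HVu)).
  assert (I1 : is_RInt (fun t => scal K1 (rho p a t)) 1 (exp (INR V))
                 (scal K1 (RInt (rho p a) 1 (exp (INR V)))))
    by (apply (is_RInt_scal (rho p a)), (RInt_correct (rho p a)); auto).
  assert (I2 : is_RInt (fun t => scal K2 (rho p a t)) (exp (INR V)) (exp u)
                 (scal K2 (RInt (rho p a) (exp (INR V)) (exp u))))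
    by (apply (is_RInt_scal (rho p a)), (RInt_correct (rho p a)); auto).
  assert (Hpt : forall t x y K, 0 < t -> Rabs x + Rabs y <= K ->
     Rabs ((Ncount p t - a * t) / t / t * (x + y)) <= K * rho p a t).
  { intros t x y K Ht HK; rewrite Rabs_mult, Rmult_comm.
    replace (Rabs ((Ncount p t - a * t) / t / t)) with (rho p a t).
    - apply Rmult_le_compat_r; [now apply rho_ge0|].
      eapply Rle_trans; [apply Rabs_triang | auto].
    - unfold rho; unfold Rdiv at 1 3; rewrite (Rabs_mult _ (/ t)), (Rabs_pos_eq (/ t)); auto.
      now apply Rlt_le, Rinv_0_lt_compat. }
  eapply Rle_trans; [refine (RInt_split_bound _ _ _ _ _ _ _ _ _ (conj HV1 HVu) I _ I1 _ I2)|].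
  - intros t Ht; apply Hpt; [lra|]; apply H1.
    rewrite <- ln_1 at 1; rewrite <- (ln_exp (INR V)); split; apply ln_le; lra.
  - intros t Ht; apply Hpt; [lra|]; apply H2.
    rewrite <- (ln_exp (INR V)) at 1; rewrite <- (ln_exp u); split; apply ln_le; lra.
  - specialize (Heps _ HVu); unfold scal; simpl; unfold mult; simpl; nra.
Qed.

(** The range [t <= e^V] contributes [C S[|g'|](u)] and the identity itself at most [a S[|g'|](u)];
    AM-GM with [A = a + C] absorbs both into half of [a S[g](u)]. The bracket collects the AM-GM
    remainder, the shift and [g''] errors for [t <= e^V], and the tail. *)
Lemma log_sum_lower p a C eps V L u l m B :
  beurling_primes p -> is_integers p (exp u) l -> is_prime_powers p (exp u) m ->
  rho_integrable p a C -> 0 <= C -> 0 < a ->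
  (forall T, exp (INR V) <= T -> RInt (rho p a) (exp (INR V)) T <= eps) ->
  (1 <= L)%nat -> INR V <= u -> 0 <= B ->
  (forall v, v <= u -> phi p v <= B) ->
  a / 2 * psum p m (bump (INR L)) u <=
  log_sum p (INR L) u l + exp 1 * B *
    (9 * (a + C) ^ 2 / (2 * a * INR L)
     + C * (30 / INR L ^ 2 * INR V * (INR L + INR V) + 30 / INR L)
     + eps * (3 + 30 / INR L)).
Proof.
  intros Hp Hl Hm HC HC0 Ha Heps HL HV HB0 HB.
  assert (H1 : 1 <= INR L) by (apply (le_INR 1); auto).
  pose proof (exp_pos 1); pose proof (pos_INR V).
  assert (HeB : 0 <= exp 1 * B) by nra; set (eB := exp 1 * B) in *.
  assert (HL1 : 0 < 30 / INR L) by (apply Rdiv_lt_0_compat; lra).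
  assert (HL2 : 0 < 30 / INR L ^ 2) by (apply Rdiv_lt_0_compat; [lra | apply pow_lt; lra]).
  set (Q := psum p m (fun w => Rabs (bump1 (INR L) w)) u).
  assert (HQ : 0 <= Q) by (apply psum_ge0; auto; intros; apply Rabs_pos).
  pose (K1 := Q + 30 / INR L ^ 2 * INR V * ((INR L + INR V) * eB) + 30 / INR L * eB).
  pose (K2 := 3 * eB + 30 / INR L * eB).
  assert (HE : Rabs (log_sum p (INR L) u l
       - a * (psum p m (bump (INR L)) u + psum p m (bump1 (INR L)) u)) <= K1 * C + K2 * eps).
  { apply (log_sum_error p a C eps V (INR L) u l m K1 K2); auto; try lra.
    - unfold K1; assert (0 <= 30 / INR L ^ 2 * INR V * ((INR L + INR V) * eB))
        by (repeat apply Rmult_le_pos; lra).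
      nra.
    - unfold K2; nra.
    - intros v Hv; unfold K1; apply Rplus_le_compat.
      + now apply psum_bump1_shift_le.
      + apply (psum_bump2_le p u); auto; lra.
    - intros v Hv; unfold K2; apply Rplus_le_compat.
      + apply (psum_bump1_le p u); auto; lra.
      + apply (psum_bump2_le p u); auto; lra. }
  assert (HA : (a + C) * Q <= a / 2 * psum p m (bump (INR L)) u + 9 * (a + C) ^ 2 / (2 * a * INR L) * eB).
  { unfold Q; rewrite <- psum_scal.
    eapply Rle_trans; [apply (psum_le p m _ (fun w => a / 2 * bump (INR L) w +
      9 * (a + C) ^ 2 / (2 * a * INR L ^ 2) * indic (0 < w <= INR L)) u Hp)|].
    - intros w; apply bump1_amgm; lra.
    - rewrite psum_plus, !psum_scal; apply Rplus_le_compat_l.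
      replace (9 * (a + C) ^ 2 / (2 * a * INR L) * eB) with
        (9 * (a + C) ^ 2 / (2 * a * INR L ^ 2) * (INR L * eB)) by (field; lra).
      apply Rmult_le_compat_l; [|apply (psum_window p u); auto; lra].
      apply Rmult_le_pos; [pose proof (pow2_ge_0 (a + C)); lra|].
      apply Rlt_le, Rinv_0_lt_compat, Rmult_lt_0_compat; [lra | apply pow_lt; lra]. }
  assert (HQ' := psum_abs p m (bump1 (INR L)) u Hp); fold Q in HQ'.
  apply Rabs_le_between in HE; apply Rabs_le_between in HQ'.
  assert (- (a * Q) <= a * psum p m (bump1 (INR L)) u) by nra.
  unfold K1, K2 in HE.
  set (P0 := psum p m (bump (INR L)) u) in *; set (P1 := psum p m (bump1 (INR L)) u) in *.
  set (c1 := 9 * (a + C) ^ 2 / (2 * a * INR L)) in *.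
  set (c2 := 30 / INR L ^ 2 * INR V) in *; set (c3 := 30 / INR L) in *.
  nra.
Qed.

(** Placing the interval from [b - 1] to [b] in the middle half of the bump requires
    [u = b + L / 4], whence the look-ahead [ell = L / 4]. *)
Lemma phi_recursion p a C :
  beurling_primes p -> 0 < a -> rho_integrable p a C -> 0 <= C -> log_remainder p a ->
  exists ell b0 D, 0 < ell /\ 0 <= D /\ forall b B, b0 <= b -> 0 <= B ->
    (forall v, v <= b + ell -> phi p v <= B) ->
    phi p b <= exp (-1) * phi p (b - 1) + D + B / 8.
Proof.
  intros Hp Ha HC HC0 HN; pose proof (exp_pos 1).
  (* Chosen so that [8192 / a * exp 1 * D0 = 1 / 8], the share of [B] in the conclusion; [8192 / a]
     inverts the factors [a / 2] and [1 / 4096]. *)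
  pose (D0 := a / (65536 * exp 1)).
  assert (HD0 : 0 < D0) by (apply Rdiv_lt_0_compat; lra).
  (* As [3 + 30 / L <= 33], the tail uses at most half of [D0]. *)
  destruct (rho_tail p a C (D0 / 66) HC ltac:(lra)) as [V HV]; pose proof (pos_INR V).
  (* [W / L] dominates the two other error terms, and the choice of [L] below makes it at most
     [D0 / 2]. *)
  pose (W := 9 * (a + C) ^ 2 / (2 * a) + 30 * C * (INR V * (1 + INR V) + 1)).
  assert (HW : 0 <= W).
  { assert (0 <= 9 * (a + C) ^ 2 / (2 * a)).
    { apply Rmult_le_pos; [pose proof (pow2_ge_0 (a + C)); lra|].
      apply Rlt_le, Rinv_0_lt_compat; lra. }
    assert (0 <= 30 * C * (INR V * (1 + INR V) + 1)) by (apply Rmult_le_pos; nra).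
    unfold W; lra. }
  destruct (INR_unbounded (2 + 2 * W / D0)) as [L HL].
  assert (HWD : 0 <= 2 * W / D0) by (apply Rmult_le_pos; [lra | apply Rlt_le, Rinv_0_lt_compat; lra]).
  assert (HL1 : (1 <= L)%nat) by (apply INR_le; simpl; lra).
  destruct (log_sum_asymptotic p a (INR L) 1 Hp HN ltac:(lra) ltac:(lra)) as [u0 Hu0].
  pose proof (bump_int_gt0 (INR L) ltac:(lra)).
  exists (INR L / 4), (Rabs u0 + INR V), (8192 / a * (a * bump_int (INR L) (INR L) + 1)).
  repeat split; [lra | apply Rmult_le_pos; [apply Rlt_le, Rdiv_lt_0_compat; lra | nra] |].
  intros b B Hb HB0 HB; set (u := b + INR L / 4).
  pose proof (Rle_abs u0); pose proof (Rabs_pos u0).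
  destruct (integers_finite p (exp u) Hp) as (l & Hl).
  destruct (prime_powers_finite p (exp u) Hp) as (m & Hm).
  assert (Hu : u0 <= u) by (unfold u; lra).
  assert (HJ := Hu0 u l Hu Hl); apply Rabs_le_between in HJ.
  assert (Hlow := log_sum_lower p a C (D0 / 66) V L u l m B Hp Hl Hm HC HC0 Ha HV HL1
    ltac:(unfold u; lra) HB0 HB).
  assert (Hwin := psum_bump_window p u m (INR L) b Hp Hm ltac:(lra) eq_refl).
  match type of Hlow with _ <= _ + _ * ?d => assert (Hd : d <= D0) end.
  { assert (Hinv : 0 < / INR L <= 1)
      by (split; [apply Rinv_0_lt_compat; lra | rewrite <- Rinv_1; apply Rinv_le_contravar; lra]).
    assert (HWL : W / INR L <= D0 / 2).
    { apply Rmult_le_reg_r with (INR L); [lra|].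
      replace (W / INR L * INR L) with W by (field; lra).
      assert (E : 2 * W / D0 * D0 = 2 * W) by (field; lra); nra. }
    assert (Hterm : C * (30 / INR L ^ 2 * INR V * (INR L + INR V) + 30 / INR L)
                    <= 30 * C * (INR V * (1 + INR V) + 1) / INR L).
    { replace (C * _) with (30 * C * (INR V * (1 + INR V * / INR L) + 1) / INR L) by (field; lra).
      apply Rmult_le_compat_r; [lra|]; apply Rmult_le_compat_l; [lra|].
      apply Rplus_le_compat_r, Rmult_le_compat_l; nra. }
    assert (E : W / INR L = 9 * (a + C) ^ 2 / (2 * a * INR L) + 30 * C * (INR V * (1 + INR V) + 1) / INR L)
      by (unfold W; field; lra).
    assert (Heps : D0 / 66 * (3 + 30 / INR L) <= D0 / 2) by (unfold Rdiv in *; nra).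
    lra. }
  assert (HeB : 0 <= exp 1 * B) by nra.
  assert (Hfin : a / 2 * psum p m (bump (INR L)) u <= a * bump_int (INR L) (INR L) + 1 + a / 65536 * B).
  { replace (a / 65536 * B) with (exp 1 * B * D0) by (unfold D0; field; lra); nra. }
  assert (Hfin2 : phi p b - exp (-1) * phi p (b - 1) <=
    8192 / a * (a * bump_int (INR L) (INR L) + 1 + a / 65536 * B)).
  { apply Rle_trans with (8192 / a * (a / 2 * psum p m (bump (INR L)) u)).
    - replace (8192 / a * (a / 2 * psum p m (bump (INR L)) u)) with (4096 * psum p m (bump (INR L)) u)
        by (field; lra); lra.
    - apply Rmult_le_compat_l; auto; apply Rlt_le, Rdiv_lt_0_compat; lra. }
  replace (8192 / a * (a * bump_int (INR L) (INR L) + 1 + a / 65536 * B)) with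
    (8192 / a * (a * bump_int (INR L) (INR L) + 1) + B / 8) in Hfin2 by (field; lra).
  lra.
Qed.

(* A recursion that looks ahead by [ell] closes on the weighted supremum of
   [f v * exp (- delta v)], with a bound uniform in [delta]. *)
Lemma recursion_bounded (f : R -> R) ell b0 D K :
  0 < ell -> 0 <= D -> 0 <= K ->
  (forall v, v <= 0 -> f v = 0) ->
  (forall v, 0 <= v -> f v <= K * (1 + v)) ->
  (forall b B, b0 <= b -> 0 <= B -> (forall v, v <= b + ell -> f v <= B) ->
     f b <= exp (-1) * f (b - 1) + D + B / 8) ->
  exists B, 0 < B /\ forall v, f v <= B.
Proof.
  intros Hell HD HK Hneg Hgrow Hrec.
  pose (E := D + K * (1 + Rabs b0)).
  assert (HE : 0 <= E) by (unfold E; pose proof (Rabs_pos b0); nra).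
  assert (Hw : forall delta v, 0 < delta -> delta * ell <= ln 2 -> f v <= 4 * E * exp (delta * v)).
  { intros delta v Hd Hdl.
    (* The weighted supremum [M] is finite because linear growth loses against the exponential
       weight. *)
    destruct (completeness (fun y => exists v, 0 <= v /\ y = f v * exp (- (delta * v)))) as [M [HM HM']].
    - exists (K * (1 + / delta)); intros y (w & Hw & ->).
      assert (Hi : 0 < / delta) by now apply Rinv_0_lt_compat.
      apply Rle_trans with (K * ((1 + / delta) * exp (delta * w)) * exp (- (delta * w))).
      + apply Rmult_le_compat_r; [apply Rlt_le, exp_pos|].
        eapply Rle_trans; [now apply Hgrow|]; apply Rmult_le_compat_l; auto.
        pose proof (exp_ineq1_le (delta * w)).
        assert (0 <= delta * w) by (apply Rmult_le_pos; lra).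
        assert (/ delta * (delta * w) = w) by (field; lra); nra.
      + rewrite exp_Ropp; apply Req_le; field; split; apply Rgt_not_eq; [lra | apply exp_pos].
    - exists (f 0 * exp (- (delta * 0))), 0; split; [lra | auto].
    - assert (HM0 : 0 <= M).
      { apply HM; exists 0; split; [lra|]; rewrite Hneg by lra; ring. }
      assert (HMv : forall v, f v <= M * exp (delta * v)).
      { intros w; pose proof (exp_pos (delta * w)).
        destruct (Rle_lt_dec w 0); [rewrite Hneg by lra; nra|].
        assert (Hs : f w * exp (- (delta * w)) <= M) by (apply HM; exists w; split; [lra | auto]).
        rewrite exp_Ropp in Hs.
        apply Rmult_le_reg_r with (/ exp (delta * w)); [now apply Rinv_0_lt_compat|].
        eapply Rle_trans; [exact Hs|]; apply Req_le; field; lra. }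
      assert (HME : M <= 4 * E).
      (* [3 / 4 = 1 / 2 + 2 / 8]: the value at [b - 1] carries [exp (-1) <= 1 / 2], and looking
         ahead by [ell] costs a factor [exp (delta * ell) <= 2] on the term [B / 8]. *)
      { assert (M <= 3 / 4 * M + E); [|lra].
        apply HM'; intros y (b & Hb & ->).
        pose proof (exp_pos (delta * b)) as Hpos.
        assert (Hge1 : 1 <= exp (delta * b)) by (rewrite <- exp_0; apply exp_monotone; nra).
        rewrite exp_Ropp.
        apply Rmult_le_reg_r with (exp (delta * b)); auto.
        replace (f b * / exp (delta * b) * exp (delta * b)) with (f b) by (field; lra).
        destruct (Rle_lt_dec b0 b) as [Hbb|Hbb].
        - assert (Hexp2 : exp (delta * ell) <= 2).
          { rewrite <- (exp_ln 2) by lra; now apply exp_monotone. }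
          assert (HB : f b <= exp (-1) * f (b - 1) + D + (2 * M * exp (delta * b)) / 8).
          { apply Hrec; auto; [apply Rmult_le_pos; lra|]; intros w Hw'.
            eapply Rle_trans; [apply HMv|].
            replace (2 * M * exp (delta * b)) with (M * (exp (delta * b) * 2)) by ring.
            apply Rmult_le_compat_l; auto.
            apply Rle_trans with (exp (delta * b + delta * ell)); [apply exp_monotone; nra|].
            rewrite exp_plus; apply Rmult_le_compat_l; lra. }
          assert (He1 : exp (-1) <= / 2).
          { replace (-1) with (- (1)) by ring; rewrite exp_Ropp.
            apply Rinv_le_contravar; [lra|]; pose proof (exp_ineq1_le 1); lra. }
          assert (Hprev : f (b - 1) <= M * exp (delta * b)).
          { eapply Rle_trans; [apply HMv|]; apply Rmult_le_compat_l; auto.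
            apply exp_monotone; nra. }
          pose proof (exp_pos (-1)).
          assert (exp (-1) * f (b - 1) <= / 2 * (M * exp (delta * b))).
          { apply Rle_trans with (exp (-1) * (M * exp (delta * b))).
            - apply Rmult_le_compat_l; lra.
            - apply Rmult_le_compat_r; auto; apply Rmult_le_pos; lra. }
          assert (D <= E) by (unfold E; pose proof (Rabs_pos b0); nra).
          nra.
        - assert (f b <= E).
          { eapply Rle_trans; [now apply Hgrow|]; unfold E.
            pose proof (Rle_abs b0); nra. }
          assert (0 <= M * exp (delta * b)) by (apply Rmult_le_pos; lra); nra. }
      eapply Rle_trans; [apply HMv|]; apply Rmult_le_compat_r; auto; apply Rlt_le, exp_pos. }
  (* For each [v > 0] the choice [delta = ln 2 / (ell + v)] is admissible in [Hw] and keeps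
     [exp (delta * v) <= 2]. The [+ 1] makes the bound positive even if [E = 0]. *)
  exists (8 * E + 1); split; [lra|]; intros v.
  assert (Hln2 : 0 < ln 2) by (rewrite <- ln_1; apply ln_increasing; lra).
  destruct (Rle_lt_dec v 0) as [Hv|Hv]; [rewrite Hneg; lra|].
  assert (Hd : 0 < ln 2 / (ell + v)) by (apply Rdiv_lt_0_compat; lra).
  assert (Hsum : ln 2 / (ell + v) * ell + ln 2 / (ell + v) * v = ln 2) by (field; lra).
  assert (H1 : 0 <= ln 2 / (ell + v) * ell) by (apply Rmult_le_pos; lra).
  assert (H2 : 0 <= ln 2 / (ell + v) * v) by (apply Rmult_le_pos; lra).
  specialize (Hw _ v Hd ltac:(lra)).
  assert (exp (ln 2 / (ell + v) * v) <= 2).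
  { rewrite <- (exp_ln 2) at 2 by lra; apply exp_monotone; lra. }
  nra.
Qed.

(** * Monotonicity and a priori growth *)

Lemma Ncount_monotone p x y : beurling_primes p -> x <= y -> 0 <= Ncount p x <= Ncount p y.
Proof.
  intros Hp Hxy; destruct (integers_finite p y Hp) as [l Hl].
  rewrite (Ncount_lsum p y l x Hl), (Ncount_lsum p y l y Hl) by lra; split.
  - apply lsum_ge0; intros; apply indic_ge0.
  - apply lsum_le; intros; apply indic_le; lra.
Qed.

Lemma psi_monotone p x y : beurling_primes p -> x <= y -> 0 <= psi p x <= psi p y.
Proof.
  intros Hp Hxy; destruct (prime_powers_finite p y Hp) as [m Hm].
  rewrite (psi_lsum p y m x Hm), (psi_lsum p y m y Hm) by lra; split.
  - apply lsum_ge0; intros; apply Rmult_le_pos; [apply indic_ge0 | now apply ln_prime_ge0].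
  - apply lsum_le; intros; apply Rmult_le_compat_r; [now apply ln_prime_ge0 | apply indic_le; lra].
Qed.

Lemma phi_nonpos_eq0 p v : beurling_primes p -> v <= 0 -> phi p v = 0.
Proof.
  intros Hp Hv; unfold phi; destruct (prime_powers_finite p (exp v) Hp) as [m Hm].
  rewrite (psi_lsum p (exp v) m (exp v) Hm), (lsum_ext _ (fun _ => 0)); [| |lra].
  - rewrite lsum_0; unfold Rdiv; ring.
  - intros [k j] _; simpl; rewrite indic_false; [ring|].
    pose proof (prime_power_ge1 p k j Hp).
    apply exp_monotone in Hv; rewrite exp_0 in Hv; lra.
Qed.

(** The remainder hypothesis gives [N(x) = O(x)], and [psi(x) <= N(x) log x] does the rest. This is
    the growth that [recursion_bounded] takes as its starting point. *)
Lemma phi_linear_growth p a :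
  beurling_primes p -> 0 < a -> log_remainder p a ->
  exists K, 0 <= K /\ forall v, 0 <= v -> phi p v <= K * (1 + v).
Proof.
  intros Hp Ha HN; destruct (HN 1 ltac:(lra)) as [X HX].
  (* From [Y >= e] on, [ln x >= 1]; the term [Ncount p Y] in [K] takes care of [1 <= x < Y]. *)
  pose (Y := Rmax X (exp 1)); pose (K := a + 1 + Ncount p Y).
  pose proof (Rmax_l X (exp 1)) as HY1; pose proof (Rmax_r X (exp 1)) as HY2; fold Y in HY1, HY2.
  pose proof (Ncount_monotone p Y Y Hp ltac:(lra)) as HNY.
  assert (HK : forall x, 1 <= x -> Ncount p x <= K * x).
  { intros x Hx; destruct (Rle_lt_dec Y x) as [H|H].
    - specialize (HX x ltac:(lra)); apply Rabs_le_between in HX.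
      assert (Hln : 1 <= ln x) by (rewrite <- (ln_exp 1); apply ln_le; [apply exp_pos | lra]).
      assert (x / ln x <= x).
      { apply Rmult_le_reg_r with (ln x); [lra|]; unfold Rdiv.
        rewrite Rmult_assoc, Rinv_l by lra; nra. }
      unfold K; nra.
    - pose proof (Ncount_monotone p x Y Hp ltac:(lra)); unfold K; nra. }
  exists K; split; [unfold K; lra|]; intros v Hv; unfold phi.
  assert (H1 : 1 <= exp v) by (rewrite <- exp_0; now apply exp_monotone).
  apply Rmult_le_reg_r with (exp v); [lra|].
  unfold Rdiv; rewrite Rmult_assoc, Rinv_l, Rmult_1_r by lra.
  eapply Rle_trans; [now apply psi_le_Ncount_ln|]; rewrite ln_exp.
  specialize (HK _ H1).
  apply Rle_trans with (K * exp v * v); [now apply Rmult_le_compat_r|].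
  assert (0 <= K * exp v) by (apply Rmult_le_pos; [unfold K|]; lra); nra.
Qed.

(** * Upper bound, lower bound and conclusion *)

Lemma phi_bounded p a C :
  beurling_primes p -> 0 < a -> rho_integrable p a C -> 0 <= C -> log_remainder p a ->
  exists B, 0 < B /\ forall v, phi p v <= B.
Proof.
  intros Hp Ha HC HC0 HN.
  destruct (phi_recursion p a C Hp Ha HC HC0 HN) as (ell & b0 & D & Hell & HD & Hrec).
  destruct (phi_linear_growth p a Hp Ha HN) as (K & HK & Hgrow).
  apply (recursion_bounded (phi p) ell b0 D K); auto.
  intros; now apply phi_nonpos_eq0.
Qed.

(** By monotonicity of [psi] only the denominator can grow. In the lower bound this compares [phi]
    at bounded distance with [phi p u] itself. *)
Lemma phi_shift p u v : beurling_primes p -> 0 <= v -> phi p (u - v) <= exp v * phi p u.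
Proof.
  intros Hp Hv; unfold phi.
  pose proof (psi_monotone p (exp (u - v)) (exp u) Hp ltac:(apply exp_monotone; lra)).
  replace (exp v * (psi p (exp u) / exp u)) with (psi p (exp u) / exp (u - v)).
  - apply Rmult_le_compat_r; [apply Rlt_le, Rinv_0_lt_compat, exp_pos | lra].
  - unfold Rminus; rewrite exp_plus, exp_Ropp; field; split; apply Rgt_not_eq, exp_pos.
Qed.

(** Once [phi] is bounded, a bump of length [1] suffices. With [g] the limit of [J(u)], the
    asymptotics and the tail each lose at most [g / 4], and all other terms are multiples of
    [phi p u], so [g / 2 <= K * phi p u]. *)
Lemma phi_bounded_below p a C :
  beurling_primes p -> 0 < a -> rho_integrable p a C -> 0 <= C -> log_remainder p a ->
  exists c u0, 0 < c /\ forall u, u0 <= u -> c <= phi p u.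
Proof.
  intros Hp Ha HC HC0 HN.
  destruct (phi_bounded p a C Hp Ha HC HC0 HN) as (B & HB0 & HB).
  pose proof (exp_pos 1) as He.
  pose (g := a * bump_int 1 1).
  assert (Hg : 0 < g) by (apply Rmult_lt_0_compat; auto; apply bump_int_gt0; lra).
  destruct (log_sum_asymptotic p a 1 (g / 4) Hp HN ltac:(lra) ltac:(lra)) as [u0 Hu0].
  assert (HeB : 0 < exp 1 * B) by nra.
  (* Here [33 = 3 + 30] adds the bounds on [bump1] and [bump2], so the tail amounts to exactly
     [g / 4]. *)
  destruct (rho_tail p a C (g / (4 * 33 * (exp 1 * B))) HC) as [V HV];
    [apply Rdiv_lt_0_compat; nra|].
  pose proof (exp_pos (INR V)); pose proof (pos_INR V).
  (* The [4 = 1 + 3] comes from [S[g]] and [S[g']] at [u], the second term from the range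
     [t <= e^V]. *)
  pose (K := 4 * a * exp 1 + 33 * (exp 1 * exp (INR V)) * C).
  assert (HK : 0 < K).
  { unfold K; assert (0 <= 33 * (exp 1 * exp (INR V)) * C); [|nra].
    repeat apply Rmult_le_pos; lra. }
  exists (g / 2 / K), (Rabs u0 + INR V); split; [apply Rdiv_lt_0_compat; lra|].
  intros u Hu; pose proof (Rle_abs u0); pose proof (Rabs_pos u0).
  destruct (integers_finite p (exp u) Hp) as (l & Hl).
  destruct (prime_powers_finite p (exp u) Hp) as (m & Hm).
  assert (HJ := Hu0 u l ltac:(lra) Hl); fold g in HJ; apply Rabs_le_between in HJ.
  assert (Hphi : 0 <= phi p u).
  { apply Rmult_le_pos; [apply (psi_monotone p _ (exp u) Hp); lra|].
    apply Rlt_le, Rinv_0_lt_compat, exp_pos. }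
  assert (Hwin : forall s, s <= u ->
    Rabs (psum p m (bump1 1) s) <= 3 * (exp 1 * phi p s) /\
    Rabs (psum p m (bump2 1) s) <= 30 * (exp 1 * phi p s)).
  { intros s Hs; assert (HW := psum_unit_window p u m s Hp Hm Hs).
    split; (eapply Rle_trans; [now apply psum_abs|]).
    - eapply Rle_trans; [apply (psum_le p m _ (fun w => 3 * indic (0 < w <= 1)) s Hp)|].
      + intros w; pose proof (bump1_le 1 w ltac:(lra)); lra.
      + rewrite psum_scal; lra.
    - eapply Rle_trans; [apply (psum_le p m _ (fun w => 30 * indic (0 < w <= 1)) s Hp)|].
      + intros w; pose proof (bump2_le 1 w ltac:(lra)); lra.
      + rewrite psum_scal; lra. }
  assert (HE : Rabs (log_sum p 1 u l - a * (psum p m (bump 1) u + psum p m (bump1 1) u))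
     <= 33 * (exp 1 * (exp (INR V) * phi p u)) * C + 33 * (exp 1 * B) * (g / (4 * 33 * (exp 1 * B)))).
  { apply (log_sum_error p a C _ V 1 u l m); auto; try lra.
    - apply Rmult_le_pos, Rmult_le_pos, Rmult_le_pos; lra.
    - intros v Hv; destruct (Hwin (u - v) ltac:(lra)).
      assert (phi p (u - v) <= exp (INR V) * phi p u).
      { eapply Rle_trans; [apply phi_shift; auto; lra|].
        apply Rmult_le_compat_r; auto; apply exp_monotone; lra. }
      assert (exp 1 * phi p (u - v) <= exp 1 * (exp (INR V) * phi p u)) by (apply Rmult_le_compat_l; lra).
      lra.
    - intros v Hv; destruct (Hwin (u - v) ltac:(lra)).
      assert (exp 1 * phi p (u - v) <= exp 1 * B) by (apply Rmult_le_compat_l; [lra | auto]).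
      lra. }
  replace (33 * (exp 1 * B) * (g / (4 * 33 * (exp 1 * B)))) with (g / 4) in HE by (field; lra).
  assert (HS0 : psum p m (bump 1) u <= exp 1 * phi p u).
  { eapply Rle_trans; [|now apply (psum_unit_window p u m u Hp Hm), Rle_refl].
    apply psum_le; auto; intros; apply bump_le; lra. }
  destruct (Hwin u ltac:(lra)) as [HS1 _].
  apply Rabs_le_between in HE; apply Rabs_le_between in HS1.
  assert (Hfin : g / 2 <= K * phi p u).
  { assert (a * (psum p m (bump 1) u + psum p m (bump1 1) u) <= a * (4 * (exp 1 * phi p u)))
      by (apply Rmult_le_compat_l; lra).
    unfold K; nra. }
  apply Rmult_le_reg_r with K; auto.
  replace (g / 2 / K * K) with (g / 2) by (field; lra); lra.
Qed.

Theorem theorem1 (p : nat -> R) (a : R) :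
  beurling_primes p ->
  0 < a ->
  (* int_1^oo |(N(x) - a x)/x| dx/x < oo *)
  (exists C : R, forall T : R, 1 <= T ->
     exists pr : Riemann_integrable
                   (fun x => Rabs ((Ncount p x - a * x) / x) / x) 1 T,
       RiemannInt pr <= C) ->
  (* N(x) = a x + o(x / log x) *)
  (forall eps : R, 0 < eps -> exists X : R, forall x : R, X <= x ->
     Rabs (Ncount p x - a * x) <= eps * (x / ln x)) ->
  (* 0 < liminf psi(x)/x *)
  (exists c : R, 0 < c /\ exists X : R, forall x : R, X <= x ->
     c <= psi p x / x) /\
  (* limsup psi(x)/x < oo *)
  (exists C : R, exists X : R, forall x : R, X <= x -> psi p x / x <= C).
Proof.
  intros Hp Ha (C & HC) HN.
  assert (HI : rho_integrable p a C).
  { intros T HT; destruct (HC T HT) as (pr & Hpr).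
    split; [exact (ex_RInt_Reals_1 _ _ _ pr)|].
    pose proof (RInt_Reals _ _ _ pr) as E; unfold rho; lra. }
  (* At [T = 1] the integral vanishes, which forces its bound [C] to be nonnegative. *)
  assert (HC0 : 0 <= C).
  { destruct (HI 1 ltac:(lra)) as [_ H]; rewrite RInt_point in H; exact H. }
  split.
  - destruct (phi_bounded_below p a C Hp Ha HI HC0 HN) as (c & u0 & Hc & H).
    exists c; split; auto; exists (exp u0); intros x Hx.
    pose proof (exp_pos u0).
    specialize (H (ln x)); unfold phi in H; rewrite exp_ln in H by lra; apply H.
    rewrite <- (ln_exp u0); apply ln_le; lra.
  - destruct (phi_bounded p a C Hp Ha HI HC0 HN) as (B & _ & H).
    exists B, 1; intros x Hx; specialize (H (ln x)); unfold phi in H; now rewrite exp_ln in H by lra.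
Qed.
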